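(* (i) For every $\varepsilon>0$ there is a constant $C_\varepsilon$ such that every set of $n$ points in $\mathbb{R}^3$ spans at most $C_\varepsilon n^{7/3+\varepsilon}$ triangles whose area equals the maximum area among all triangles spanned by the set. (ii) There is an absolute constant $c>0$ such that for all $n\ge 3$ there exists a set of $n$ points in $\mathbb{R}^3$ spanning at least $c\,n^{4/3}$ triangles of maximum area.
   Context: A triangle spanned by a point set is an unordered triple of its points.
   Formalization: Triangles are required to be non-degenerate (three points not on a line): otherwise n collinear points span about n^3/6 triples, all of the maximum area 0, and (i) fails; for sets not contained in a line the maximum-area triples are unchanged. *)

(* Defs.v *)
From HB Require Import structures.
From mathcomp Require Import all_boot all_order all_algebra finmap ring.
From mathcomp Require Import all_classical all_reals all_analysis.

Set Implicit Arguments.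
Unset Strict Implicit.
Unset Printing Implicit Defensive.
Import Order.TTheory GRing.Theory Num.Theory.
Local Open Scope fset_scope.
Local Open Scope ring_scope.

(* Index arithmetic takes place in 'I_3, i.e. modulo 3. *)
Definition crossmul (R : realType) (u v : 'rV[R]_3) : 'rV[R]_3 :=
  \row_(k < 3) (u 0 (k + 1) * v 0 (k + 2) - u 0 (k + 2) * v 0 (k + 1)).

(* The library norm `|u| on row vectors is the sup norm, not this one. *)
Definition norm2 (R : realType) (u : 'rV[R]_3) : R :=
  Num.sqrt (\sum_i u 0 i ^+ 2).

Definition area (R : realType) (a b c : 'rV[R]_3) : R :=
  norm2 (crossmul (b - a) (c - a)) / 2.

Definition collinear (R : realType) (T : {fset 'rV[R]_3}) : Prop :=
  exists p v : 'rV[R]_3, forall x, x \in T -> exists t : R, x = p + t *: v.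

(* Triangles are nondegenerate: if collinear triples were kept, all of the
   ~ n^3 / 6 triples of a collinear n-point set would have the maximum area 0.
   For a point set not contained in a line the maximum area is positive, so
   keeping them would not change which triples have maximum area. *)
Definition triangles (R : realType) (P : {fset 'rV[R]_3}) :
    {fset {fset 'rV[R]_3}} :=
  [fset T in fpowerset P | (#|` T| == 3%N) && ~~ `[< collinear T >]].

(* [area] is symmetric, so the order in which the vertices are listed is
   irrelevant; see [tri_areaE]. *)
Definition tri_area (R : realType) (T : {fset 'rV[R]_3}) : R :=
  let s := enum_fset T in area s`_0 s`_1 s`_2.

Definition max_area_triangles (R : realType) (P : {fset 'rV[R]_3}) :
    {fset {fset 'rV[R]_3}} :=
  [fset T in triangles P |
    `[< forall T', T' \in triangles P -> tri_area T' <= tri_area T >]].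

Lemma area_swap23 (R : realType) (a b c : 'rV[R]_3) : area a b c = area a c b.
Proof.
rewrite /area /norm2; congr (Num.sqrt _ / 2); apply: eq_bigr => i _.
by rewrite !mxE; ring.
Qed.

Lemma area_swap12 (R : realType) (a b c : 'rV[R]_3) : area a b c = area b a c.
Proof.
rewrite /area /norm2; congr (Num.sqrt _ / 2); apply: eq_bigr => i _.
by rewrite !mxE; ring.
Qed.

Lemma tri_areaE (R : realType) (a b c : 'rV[R]_3) :
  uniq [:: a; b; c] -> tri_area [fset a; b; c] = area a b c.
Proof.
move=> u3; rewrite /tri_area; set s := enum_fset _.
have : perm_eq s [:: a; b; c].
  apply: uniq_perm => //; first exact: fset_uniq.
  by move=> x; rewrite /s -[x \in enum_fset _]/(x \in [fset a; b; c]) !inE orbA.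
have su : uniq s by exact: fset_uniq.
move: s su => s su ps; have := perm_size ps; have := perm_mem ps.
case: s su {ps} => [|x [|y [|z []]]] //= su mem _.
have := mem x; have := mem y; have := mem z.
rewrite !inE !eqxx !orbT /=.
move: su u3; rewrite !inE !negb_or !andbT.
move=> /andP[/andP[xy xz] yz] _.
move=> /esym/or3P[]/eqP ez /esym/or3P[]/eqP ey /esym/or3P[]/eqP ex; subst x y z;
  try by [move: xy; rewrite eqxx | move: xz; rewrite eqxx
         | move: yz; rewrite eqxx].
- by rewrite area_swap23 area_swap12 area_swap23.
- by rewrite area_swap23 area_swap12.
- by rewrite area_swap12 area_swap23.
- by rewrite area_swap23.
- by rewrite area_swap12.
- by [].
Qed.

(* Main.v *)
Require Import Defs.
From mathcomp Require Import all_boot all_order all_algebra finmap.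
From mathcomp Require Import all_classical all_reals all_analysis.
From mathcomp Require Import ring lra zify.

Set Implicit Arguments.
Unset Strict Implicit.
Unset Printing Implicit Defensive.
Import Order.TTheory GRing.Theory Num.Theory.
Local Open Scope fset_scope.
Local Open Scope ring_scope.

(** Upper bound. Fix a vertex [a] and write [x = b - a] for the other points [b].
    The pairs [(x, u)] spanning a triangle of maximum area with [a] are the
    incidences between points [x] and cylinders with axis [u] through the origin,
    and all points lie inside all cylinders. On the cylinder of [u0] the other
    cylinders cut out, on each generating line, an interval; so the part of that
    cylinder on the boundary of the common intersection lies between an upper and
    a lower envelope of curves meeting pairwise boundedly often, and
    Davenport-Schinzel bounds make these envelopes of almost linear complexity.
    This gives almost [n^2] pairs of incidences sharing a point, hence, for [X]
    points and [U] cylinders, [I <= C (|U| + sqrt |U| |X|^(1 + eps))]. Hitting all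
    large conflict lists by a sample of about [n^(1/3)] cylinders splits the points
    into about [n^(2/3)] cells, each met by at most [n^(2/3)] cylinders, and summing
    the previous bound over the cells yields [n^(4/3 + eps)] incidences for each [a].

    Lower bound. Take the origin and unit vectors clustered around the first two
    coordinate axes; a triangle has area at most [1/2], with equality when it joins
    the origin to two orthogonal vectors. Orthogonality encodes point-line
    incidences, and a grid provides [n^(4/3)] of them. *)

(** * Davenport-Schinzel words *)

Section Changes.
Local Open Scope nat_scope.
Variable T : eqType.
Implicit Types (s A B C : seq T) (P : pred T).

Fixpoint changes s : nat :=
  if s is x :: s' then (x != head x s') + changes s' else 0.

Lemma changes_eq0 s : (changes s == 0) = constant s.
Proof.
elim: s => // x [|y s] IH /=; first by rewrite eqxx.
rewrite addn_eq0 eqb0 negbK; by have [->|//] := eqVneq x y; exact: IH.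
Qed.

Lemma changes_behead x s : changes s <= changes (x :: s).
Proof. exact: leq_addl. Qed.

Lemma changes_cons_le x s : changes (x :: s) <= (changes s).+1.
Proof. by rewrite -addn1 addnC leq_add2r leq_b1. Qed.

Lemma changes_cons2_le x y s : changes (x :: s) <= changes [:: x, y & s].
Proof.
case: s => [|z s] /=; first by rewrite eqxx.
rewrite [leqRHS]addnA leq_add2r; have [->|_] := eqVneq x y; first by rewrite add0n.
exact: leq_trans (leq_b1 _) (leq_addr _ _).
Qed.

Lemma changes_cat_ge s1 s2 : changes s1 + changes s2 <= changes (s1 ++ s2).
Proof.
elim: s1 => [|x [|y s1] IH]; first by rewrite add0n.
  by rewrite /= eqxx; exact: changes_behead.
by rewrite /= -addnA leq_add2l.
Qed.

Lemma changes_cat_le s1 s2 : changes (s1 ++ s2) <= (changes s1 + changes s2).+1.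
Proof.
elim: s1 => [|x [|y s1] IH]; first exact: leqnSn.
  by rewrite /= eqxx; exact: changes_cons_le.
by rewrite /= -!addnA -addnS leq_add2l addnA.
Qed.

Lemma changes_rcons_cat s z s2 :
  changes (rcons s z ++ s2) = changes (rcons s z) + changes (z :: s2).
Proof.
elim: s => [|x s IH] /=; first by rewrite eqxx.
by rewrite IH addnA; case: (s).
Qed.

Lemma changes_rev s : changes (rev s) = changes s.
Proof.
elim: s => [|x [|y s] IH] //.
rewrite rev_cons -cats1 rev_cons changes_rcons_cat -rev_cons IH /=.
by rewrite eqxx !addn0 addnC eq_sym.
Qed.

Lemma changes_subseq s1 s2 : subseq s1 s2 -> changes s1 <= changes s2.
Proof.
have keep_head x t1 t2 : subseq t1 t2 -> changes (x :: t1) <= changes (x :: t2).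
  elim: t2 t1 x => [|y t2 IH] [|z t1] x //=; first by rewrite eqxx.
  case: eqP => [->|_] t12; first by rewrite leq_add2l IH.
  exact: leq_trans (IH _ x t12) (changes_cons2_le _ _ _).
elim: s2 s1 => [|y s2 IH] [|z s1] //=; case: eqP => [->|_] s12.
  exact: keep_head.
exact: leq_trans (IH _ s12) (changes_behead _ _).
Qed.

Lemma changes_cat_gt s1 s2 :
  s1 != [::] -> ~~ constant s2 -> changes s1 < changes (s1 ++ s2).
Proof.
case/lastP: s1 => // s z _ s2NC; rewrite changes_rcons_cat -addn1 leq_add2l lt0n.
rewrite changes_eq0; apply: contra s2NC => /all_pred1_constant.
by case: s2 => // x s2 /andP[/eqP -> /all_pred1_constant].
Qed.

Lemma leq_size_changes s : uniq s -> size s <= (changes s).+1.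
Proof.
elim: s => [|x [|y s] IH] //= /andP[xNs /IH le_s].
by move: xNs; rewrite inE negb_or => /andP[-> _].
Qed.

Lemma size_flatten_changes (ss : seq (seq T)) :
  all uniq ss -> size (flatten ss) <= size ss + changes (flatten ss).
Proof.
elim: ss => //= s ss IH /andP[/leq_size_changes le_s /IH le_ss].
by rewrite size_cat; have := changes_cat_ge s (flatten ss); lia.
Qed.

Lemma changes_take s k : k <= changes s -> exists i, changes (take i s) = k.
Proof.
elim: s k => [|x s IH] k; first by rewrite leqn0 => /eqP->; exists 0.
have [->|k_gt0] := posnP k; first by exists 0.
case: s IH => [|y s] IH le_k; first by move: le_k k_gt0; rewrite /= eqxx; case: k.
have [|i take_i] := IH (k - (x != y)); first by rewrite leq_subLR.
have kE : (x != y) + (k - (x != y)) = k by rewrite subnKC // (leq_trans (leq_b1 _)).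
case: i take_i => [|i] take_i; last by exists i.+2; rewrite /= -[in RHS]kE -take_i.
by exists 2; rewrite /= take0 /= eqxx addn0 -[in RHS]kE -take_i take0 addn0.
Qed.

Lemma changes_halve s : exists s1 s2,
  [/\ s = s1 ++ s2, changes s + 2 <= 2 * (changes s1 + 2)
    & changes s + 2 <= 2 * (changes s2 + 2)].
Proof.
have [|i take_i] := @changes_take s (changes s)./2; first by lia.
exists (take i s), (drop i s); rewrite cat_take_drop.
have := changes_cat_le (take i s) (drop i s); rewrite cat_take_drop take_i.
by split=> //; lia.
Qed.

Definition ds_word K s := forall a b, changes [seq x <- s | pred2 a b x] <= K.

Lemma ds_wordP K s :
  {in s &, forall a b, a != b -> changes [seq x <- s | pred2 a b x] <= K} -> ds_word K s.
Proof.
move=> sK a b.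
have constant_case c : {in s, forall x, pred2 a b x -> x = c} ->
    changes [seq x <- s | pred2 a b x] <= K.
  move=> s_c; suff: constant [seq x <- s | pred2 a b x] by rewrite -changes_eq0 => /eqP->.
  apply: (@all_pred1_constant _ c); apply/allP => x.
  by rewrite mem_filter => /andP[xab /s_c ->] //=.
have [ab|aNb] := eqVneq a b.
  by apply: (constant_case b) => x _ /=; rewrite ab orbb => /eqP.
have [as_|aNs] := boolP (a \in s); last first.
  by apply: (constant_case b) => x xs /orP[]/eqP // xa; rewrite -xa xs in aNs.
have [bs|bNs] := boolP (b \in s); last first.
  by apply: (constant_case a) => x xs /orP[]/eqP // xb; rewrite -xb xs in bNs.
exact: sK.
Qed.

Lemma ds_word_subseq K s1 s2 : subseq s1 s2 -> ds_word K s2 -> ds_word K s1.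
Proof.
move=> s12 s2K a b; apply: leq_trans (s2K a b); apply: changes_subseq.
by rewrite subseq_filter filter_all (subseq_trans (filter_subseq _ _)).
Qed.

Lemma ds_word_rev K s : ds_word K s -> ds_word K (rev s).
Proof. by move=> sK a b; rewrite filter_rev changes_rev. Qed.

Lemma changes_ds_word0 s : ds_word 0 s -> changes s = 0.
Proof.
elim: s => // x [|y s] IH sK; first by rewrite /= eqxx.
rewrite /= in IH *; rewrite IH ?addn0.
  by have := sK x y; rewrite /= !eqxx orbT /=; case: eqP.
by apply: ds_word_subseq sK; exact: subseq_cons.
Qed.

Lemma changes_filter_cat_gt P s1 x s2 a : has P s1 -> P x -> a != x ->
  {in s1, forall y, P y -> y = a} ->
  changes (seq.filter P (x :: s2)) < changes (seq.filter P (s1 ++ x :: s2)).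
Proof.
move=> s1P Px ax s1a; rewrite filter_cat.
have: all (pred1 a) (seq.filter P s1).
  by apply/allP => y; rewrite mem_filter => /andP[Py /s1a ->] //=.
move: s1P; rewrite has_filter; case/lastP: (seq.filter P s1) => // t y _.
rewrite all_rcons => /andP[/eqP -> _]; rewrite changes_rcons_cat /= Px /= ax.
by rewrite addnCA add1n ltnS leq_addl.
Qed.

Section GreedyCut.
Variables (x : T) (s : seq T).

Let first P := head x (seq.filter P (x :: s)).

Lemma first_filterC P Q : Q =1 predC P -> P (first Q) -> first Q = first P.
Proof.
move=> QE; rewrite /first /= !QE /=; have [_|/negPf Px] := boolP (P x); last first.
  by rewrite /= Px.
move: (filter_all Q s); case: (seq.filter Q s) => //= y t.
by rewrite QE /= => /andP[/negPf ->].
Qed.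

Lemma changes_filterC_cut P Q s1 y s2 : Q =1 predC P -> x :: s = s1 ++ y :: s2 ->
  all (pred2 (first P) (first Q)) s1 -> P y -> first P != y ->
  changes (seq.filter P (y :: s2)) + changes (seq.filter Q (y :: s2)) <
  changes (seq.filter P (x :: s)) + changes (seq.filter Q (x :: s)).
Proof.
move=> QE sE s1_first Py firstNy; rewrite -addSn leq_add //.
  rewrite sE (@changes_filter_cat_gt _ _ _ _ (first P)) //.
    apply: contraNT firstNy => /negPf s1P; rewrite /first sE filter_cat.
    by move: s1P; rewrite has_filter => /negbFE/eqP ->; rewrite /= Py.
  move=> z /(allP s1_first)/orP[]/eqP -> //; exact: first_filterC.
by apply: changes_subseq; rewrite sE filter_cat suffix_subseq.
Qed.

Lemma cut_two_letters P : exists a b s1 s2,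
  [/\ x :: s = s1 ++ s2, all (pred2 a b) s1
    & s2 = [::] \/
      changes (seq.filter P s2) + changes (seq.filter (predC P) s2) <
      changes (seq.filter P (x :: s)) + changes (seq.filter (predC P) (x :: s))].
Proof.
have PE : P =1 predC (predC P) by move=> y; rewrite /= negbK.
exists (first P), (first (predC P)); set ab := pred2 _ _.
have [sab|] := boolP (all ab (x :: s)).
  by exists (x :: s), [::]; split; rewrite ?cats0 //; left.
rewrite -has_predC; move sE: (x :: s) => s' s'Nab.
case: (split_find s'Nab) sE => y s1 s2 /=; rewrite negb_or eq_sym [y == _]eq_sym.
move=> /andP[yNP yNC]; rewrite has_predC negbK cat_rcons => s1ab sE.
exists s1, (y :: s2); split=> //; right; rewrite -sE.
have [Py|Py] := boolP (P y); first exact: (changes_filterC_cut _ sE).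
rewrite addnC [X in _ < X]addnC; apply: (changes_filterC_cut _ sE) => //.
by apply: sub_all s1ab => z; rewrite /= orbC.
Qed.

End GreedyCut.

(* Cut [s] greedily into segments with at most one letter in [P] and at most
   one outside: every cut is paid for by a change in one of the two subwords. *)
Lemma changes_ds_word_filterC K P s : ds_word K s ->
  changes s <= K.+1 * (changes (seq.filter P s) + changes (seq.filter (predC P) s)).+1.
Proof.
set w := fun s => changes (seq.filter P s) + changes (seq.filter (predC P) s).
have [n] := ubnP (w s); elim: n s => // n IH [|x s] // ws sK.
have [a [b [s1 [s2 [sE s1ab s2w]]]]] := cut_two_letters x s P.
have s1K : changes s1 <= K.
  rewrite -(all_filterP s1ab); apply: leq_trans (sK a b).
  by rewrite sE filter_cat; apply/changes_subseq/prefix_subseq.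
case: s2w sE => [-> ->|s2w sE].
  by rewrite cats0 (leq_trans s1K) // mulnS; lia.
have {}IH : changes s2 <= K.+1 * (w s2).+1.
  apply: IH; first by apply: leq_trans s2w _.
  by apply: ds_word_subseq sK; rewrite sE suffix_subseq.
have := changes_cat_le s1 s2; rewrite -sE; move: s2w; rewrite -/(w s2) -/(w (x :: s)).
nia.
Qed.

Definition inner_letters A B C := [seq x <- B | (x \notin A) && (x \notin C)].

Lemma infix_few_inner_letters j s : exists A B C,
  [/\ s = A ++ B ++ C, changes s + 2 <= 2 ^ j * (changes B + 2)
    & 2 ^ j * size (undup (inner_letters A B C)) <= size (undup s)].
Proof.
elim: j => [|j [A [B [C [sE le_s szB]]]]].
  exists [::], s, [::]; split; rewrite ?cats0 ?expn0 ?mul1n //.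
  by rewrite /inner_letters (eq_filter (a2 := predT)) ?filter_predT.
have [B1 [B2 [BE le_B1 le_B2]]] := changes_halve B.
pose I1 := undup (inner_letters A B1 (B2 ++ C)).
pose I2 := undup (inner_letters (A ++ B1) B2 C).
have : size I1 + size I2 <= size (undup (inner_letters A B C)).
  rewrite -size_cat; apply: uniq_leq_size.
    rewrite cat_uniq !undup_uniq /= andbT; apply/hasPn => x.
    rewrite !mem_undup !mem_filter !mem_cat !negb_or => /andP[/andP[/andP[_ xB] _] _].
    by rewrite (negbTE xB) andbF.
  move=> x; rewrite mem_cat !mem_undup !mem_filter BE !mem_cat !negb_or.
  by case/orP=> [/andP[/and3P[-> _ ->] ->]|/andP[/andP[/andP[-> _] ->] ->]] //; rewrite orbT.
have [le12|le21] := leqP (size I1) (size I2) => sI.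
- exists A, B1, (B2 ++ C); split; first by rewrite sE BE -catA.
    by rewrite expnS; nia.
  by rewrite expnS -/I1; nia.
- exists (A ++ B1), B2, C; split; first by rewrite sE BE -!catA.
    by rewrite expnS; nia.
  by rewrite expnS -/I2; nia.
Qed.

(* A further occurrence in [C] of two letters alternating in [B] adds one more
   alternation. *)
Lemma ds_word_recurring K B C :
  ds_word K.+1 (B ++ C) -> ds_word K [seq x <- B | x \in C].
Proof.
move=> BCK a b; set s := seq.filter _ _.
have [|sNC] := boolP (constant s); first by rewrite -changes_eq0 => /eqP ->.
have s_ab x : x \in s -> pred2 a b x /\ x \in C.
  by rewrite !mem_filter => /and3P[].
have CNC : ~~ constant [seq x <- C | pred2 a b x].
  apply: contra sNC => /(constantP a)[x CE]; apply: (@all_pred1_constant _ x).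
  apply/allP => y /s_ab[yab yC].
  have : y \in [seq x <- C | pred2 a b x] by rewrite mem_filter yab.
  by rewrite CE mem_nseq => /andP[].
have sN0 : s != [::] by apply: contraNneq sNC => ->.
rewrite -ltnS; apply: leq_trans (changes_cat_gt sN0 CNC) _.
apply: leq_trans (BCK a b); apply: changes_subseq.
rewrite filter_cat cat_subseq // subseq_filter filter_all.
by rewrite (subseq_trans (filter_subseq _ _)) ?filter_subseq.
Qed.

Lemma ds_word_recurred K A B :
  ds_word K.+1 (A ++ B) -> ds_word K [seq x <- B | x \in A].
Proof.
move=> /ds_word_rev; rewrite rev_cat => /ds_word_recurring /ds_word_rev.
by rewrite filter_rev revK (eq_filter (a2 := mem A)) // => x; rewrite mem_rev.
Qed.

Lemma changes_infix_recursion K A B C : ds_word K.+1 (A ++ B ++ C) ->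
  exists B1 B2, [/\ ds_word K B1 /\ {subset B1 <= B}, ds_word K B2 /\ {subset B2 <= B}
    & changes B <= K.+2 * (changes (inner_letters A B C)
                           + K.+2 * (changes B1 + changes B2 + 1) + 1)].
Proof.
move=> sK; pose P x := (x \notin A) && (x \notin C).
pose outer := seq.filter (predC P) B.
exists (seq.filter (mem C) outer), (seq.filter (predC (mem C)) outer).
have BK : ds_word K.+1 B.
  by apply: ds_word_subseq sK; rewrite (subseq_trans (prefix_subseq B C)) ?suffix_subseq.
have outerK : ds_word K.+1 outer by apply: ds_word_subseq BK; exact: filter_subseq.
have sub Q s : {subset seq.filter Q s <= s} by move=> x; rewrite mem_filter => /andP[].
split; try split; try by move=> x /sub/sub.
- apply: (@ds_word_subseq _ _ [seq x <- B | x \in C]).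
    by rewrite -filter_predI (eq_filter (a2 := predI (predC P) (mem C))) ?filter_predI
      ?filter_subseq // => x; rewrite /= andbC.
  by apply: ds_word_recurring; apply: ds_word_subseq sK; exact: suffix_subseq.
- apply: (@ds_word_subseq _ _ [seq x <- B | x \in A]).
    rewrite -filter_predI subseq_filter filter_subseq andbT.
    apply/allP => x; rewrite mem_filter /= /P negb_and !negbK.
    by case: (x \in A); case: (x \in C).
  apply: ds_word_recurred; apply: ds_word_subseq sK.
  by rewrite catA prefix_subseq.
apply: leq_trans (changes_ds_word_filterC P BK) _.
by rewrite !addn1 leq_pmul2l // ltnS leq_add2l changes_ds_word_filterC.
Qed.

Lemma uniq_subseq1 s x : uniq s -> {in s, forall y, y = x} -> subseq s [:: x].
Proof.
case: s => [|y [|z s]] //= yU s_x; first by rewrite (s_x y) ?mem_head ?eqxx.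
have yx := s_x y (mem_head _ _); have zx : z = x by apply: s_x; rewrite !inE eqxx orbT.
by move: yU; rewrite yx zx mem_head.
Qed.

End Changes.

Section Powers.
Variable R : realType.
Implicit Types (x y a b c : R) (m n : nat).

Lemma powR_ge1 x a : 1 <= x -> 0 <= a -> 1 <= x `^ a.
Proof. by move=> x_ge1 a_ge0; rewrite -[leLHS](powRr0 x) ler_powR. Qed.

Lemma gt0_powRD x a b : 0 < x -> x `^ (a + b) = x `^ a * x `^ b.
Proof. by move=> x_gt0; rewrite powRD // (gt_eqF x_gt0) implybT. Qed.

Lemma powR1D_le a b c x y : 0 <= a -> 0 < b -> 0 <= x -> b * x <= y ->
  c <= b `^ a -> c * b * x `^ (1 + a) <= y `^ (1 + a).
Proof.
move=> a_ge0 b_gt0 x_ge0 bx_le_y c_le; have b_ge0 := ltW b_gt0.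
apply: (@le_trans _ _ ((b * x) `^ (1 + a))).
  rewrite powRM // ler_wpM2r ?powR_ge0 // gt0_powRD // powRr1 //.
  by rewrite mulrC ler_wpM2l.
have bx_ge0 : 0 <= b * x by rewrite mulr_ge0.
rewrite ge0_ler_powR ?nnegrE //; first by lra.
exact: le_trans bx_ge0 bx_le_y.
Qed.

Lemma ler_nat_powR m n a : 0 <= a -> (m <= n)%N -> m%:R `^ a <= n%:R `^ a.
Proof. by move=> a_ge0 le_mn; rewrite ge0_ler_powR ?nnegrE ?ler_nat. Qed.

Lemma exists_exp2_powR_ge a x : 0 < a -> 0 <= x ->
  exists2 j, (0 < j)%N & x <= (2 ^ j)%:R `^ a.
Proof.
move=> a_gt0 x_ge0; pose y := x `^ a^-1; have y_ge0 : 0 <= y by exact: powR_ge0.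
exists (Num.truncn y).+1 => //.
have -> : x = y `^ a by rewrite -powRrM mulVf ?gt_eqF // powRr1.
rewrite ge0_ler_powR ?nnegrE ?ler0n ?(ltW a_gt0) //.
have /andP[_ /ltW/le_trans->//] := truncn_itv y_ge0.
by rewrite ler_nat ltnW // ltn_expl.
Qed.

Lemma ln_le_powR x a : 0 < x -> 0 < a -> ln x <= x `^ a / a.
Proof.
move=> x_gt0 a_gt0; rewrite ler_pdivlMr // mulrC /powR gt_eqF //.
by have := expR_ge1Dx (a * ln x); lra.
Qed.

End Powers.

Section DavenportSchinzel.
Variable R : realType.
Implicit Types eps : R.

Definition ds_bound (K : nat) (r C : R) := forall (T : eqType) (s : seq T),
  ds_word K s -> (changes s)%:R <= C * (size (undup s))%:R `^ r.

Lemma ds_recurrence (k b C p w wB wI w1 w2 : R) (D := 2 + k * (k * (2 * C + 1) + 1)) :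
  1 <= k -> 1 <= b -> 0 <= C -> 1 <= p -> 2 * k * b * wI <= 2 * b * D * p ->
  w1 <= C * p -> w2 <= C * p -> wB <= k * (wI + k * (w1 + w2 + 1) + 1) ->
  w + 2 <= b * (wB + 2) -> w <= 2 * b * D * p.
Proof.
move=> k_ge1 b_ge1 C_ge0 p_ge1 wI_le w1_le w2_le wB_le w_le.
have le_outer : k * (w1 + w2 + 1) <= k * (2 * C + 1) * p.
  by rewrite -mulrA ler_wpM2l; lra.
have le_wB : wB <= k * wI + k * (k * (2 * C + 1) + 1) * p.
  apply: le_trans wB_le _; rewrite -mulrA -mulrDr ler_wpM2l; lra.
have : b * (wB + 2) <= b * (k * wI) + b * (D * p).
  by rewrite -mulrDr ler_wpM2l /D; lra.
lra.
Qed.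

Theorem davenport_schinzel eps K : 0 < eps -> exists2 C : R, 0 <= C & ds_bound K (1 + eps) C.
Proof.
move=> eps_gt0; elim: K => [|K [C C_ge0 IHK]].
  by exists 0 => // T s /changes_ds_word0 ->; rewrite mul0r.
pose k : R := K.+2%:R; have k_ge1 : 1 <= k by rewrite ler1n.
have [|j j_gt0 kb] := @exists_exp2_powR_ge _ eps (2 * k) eps_gt0; first by lra.
set b : R := (2 ^ j)%:R in kb; have b_ge1 : 1 <= b by rewrite ler1n expn_gt0.
have b_ge0 : 0 <= b by lra.
pose D := 2 + k * (k * (2 * C + 1) + 1); have D_ge0 : 0 <= D by rewrite /D; nra.
exists (2 * b * D); first by rewrite !mulr_ge0; lra.
move=> T s; have [n] := ubnP (size (undup s)); elim: n s => // n IHn s le_n sK.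
have [A [B [C' [sE le_s szI]]]] := infix_few_inner_letters j s.
have [-> | sN0] := eqVneq s [::]; first by rewrite powR0 ?mulr0 //; lra.
set N := size (undup s) in le_n szI *; set M := size (undup _) in szI.
have N_gt0 : (0 < N)%N by rewrite lt0n size_eq0; apply: contraNneq sN0 => /undup_nil ->.
have ltMN : (M < N)%N.
  by have := leq_pexp2l (isT : (0 < 2)%N) j_gt0; nia.
rewrite sE in sK; have [B1 [B2 [[B1K sB1] [B2K sB2] le_B]]] := changes_infix_recursion sK.
have le_outer W : ds_word K W -> {subset W <= B} -> (changes W)%:R <= C * N%:R `^ (1 + eps).
  move=> WK sWB; apply: le_trans (IHK _ _ WK) _.
  rewrite ler_wpM2l // ler_nat_powR //; first by lra.
  apply: uniq_leq_size (undup_uniq _) _ => x; rewrite !mem_undup sE !mem_cat => /sWB ->.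
  by rewrite orbT.
have le_inner : 2 * k * b * (changes (inner_letters A B C'))%:R <=
    2 * b * D * N%:R `^ (1 + eps).
  apply: (@le_trans _ _ (2 * b * D * (2 * k * b * M%:R `^ (1 + eps)))).
    rewrite [leRHS]mulrCA ler_wpM2l ?mulr_ge0 //; try lra.
    apply: IHn; first by rewrite -ltnS (leq_trans _ le_n).
    apply: ds_word_subseq sK; apply: subseq_trans (filter_subseq _ _) _.
    by rewrite (subseq_trans (prefix_subseq B C')) ?suffix_subseq.
  by rewrite ler_wpM2l ?mulr_ge0 ?powR1D_le //; try lra; rewrite -natrM ler_nat.
apply: (ds_recurrence (wB := (changes B)%:R) _ _ C_ge0 _ le_inner
  (le_outer _ B1K sB1) (le_outer _ B2K sB2)) => //.
- by rewrite powR_ge1 ?ler1n //; lra.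
- by move: le_B; rewrite -(ler_nat R) natrM !(natrM, natrD).
- by move: le_s; rewrite -(ler_nat R) !(natrM, natrD).
Qed.

End DavenportSchinzel.

(** * Sign changes of polynomials *)

Section ChangesMap.
Local Open Scope nat_scope.
Variables (X : Type) (S S1 S2 : eqType).
Variables (f : X -> S) (g : X -> S1) (h : X -> S2).
Implicit Types (x y : X) (s : seq X).

Lemma changes_map_cst (c : S) s : changes [seq c | _ <- s] = 0.
Proof. by elim: s => // x [|y s] IH; rewrite /= eqxx. Qed.

Lemma changes_map_le_add s : (forall x y, g x = g y -> h x = h y -> f x = f y) ->
  changes (map f s) <= changes (map g s) + changes (map h s).
Proof.
move=> fE; elim: s => [|x [|y s] /= IH] //=; first by rewrite !eqxx.
rewrite addnACA leq_add //.
have [gxy|_] := eqVneq (g x) (g y); last exact: leq_trans (leq_b1 _) (leq_addr _ _).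
have [hxy|_] := eqVneq (h x) (h y); last exact: leq_b1.
by rewrite (fE x y) ?eqxx.
Qed.

Lemma changes_map_le s :
  (forall x y, g x = g y -> f x = f y) -> changes (map f s) <= changes (map g s).
Proof.
move=> fE; elim: s => [|x [|y s] /= IH] //=; first by rewrite !eqxx.
rewrite leq_add //; have [gxy|_] := eqVneq (g x) (g y); last exact: leq_b1.
by rewrite (fE x y) ?eqxx.
Qed.

End ChangesMap.

Section SignChanges.
Variable R : rcfType.
Implicit Types (p : {poly R}) (ws : seq R).

Lemma changes_sgr_subr ws (z : R) : sorted <=%R ws ->
  (changes [seq Num.sg (w - z) | w <- ws] <= 2)%N.
Proof.
have potential w ws' : path <=%R w ws' ->
    (changes [seq Num.sg (u - z) | u <- w :: ws'])%:R <= 1 - Num.sg (w - z).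
  elim: ws' w => [|y s IH] w /=; first by rewrite eqxx subr_ge0; case: sgrP => _ //; lra.
  move=> /andP[le_wy /IH le_tail].
  have : (Num.sg (w - z) != Num.sg (y - z))%:R <= Num.sg (y - z) - Num.sg (w - z).
    have [->|] := eqVneq; first by rewrite subrr.
    by case: sgrP => ?; case: sgrP => ?; rewrite ?eqxx //= => _; lra.
  by move: le_tail; rewrite /= !natrD; lra.
case: ws => // w ws /potential; rewrite -(ler_nat R) => /le_trans; apply.
by case: sgrP => _; lra.
Qed.

Lemma sgr_horner_rootless p (x y : R) :
  (forall z, ~~ root p z) -> Num.sg p.[x] = Num.sg p.[y].
Proof.
move=> pN0; wlog le_xy : x y / x <= y => [W|].
  by case: (leP x y) => [/W //|/ltW/W ->].
have ivt q : q.[x] <= 0 <= q.[y] -> exists z, root q z.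
  by move=> /(poly_ivt le_xy)[z _ qz]; exists z.
have nz z : p.[z] != 0 by rewrite -rootE.
case: (sgrP p.[x]) (nz x); rewrite ?eqxx // => px _;
  case: (sgrP p.[y]) (nz y); rewrite ?eqxx // => py _.
- have [|z] := ivt (- p); first by rewrite !hornerN; lra.
  by rewrite rootN (negPf (pN0 z)).
- by have [|z] := ivt p; rewrite ?(negPf (pN0 z)) //; lra.
Qed.

Lemma changes_sgr_horner p ws : sorted <=%R ws ->
  (changes [seq Num.sg p.[w] | w <- ws] <= 2 * size p)%N.
Proof.
move=> ws_sorted; have [n] := ubnP (size p); elim: n p => // n IH p le_n.
have [->|p_neq0] := eqVneq p 0.
  by under eq_map do rewrite horner0 sgr0; rewrite changes_map_cst.
have [[z /factor_theorem[q pE]]|rootless] := EM (exists z, root p z); last first.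
  have pN0 z : ~~ root p z by apply/negP => pz; apply: rootless; exists z.
  under eq_map do rewrite (sgr_horner_rootless _ 0 pN0).
  by rewrite changes_map_cst.
have q_neq0 : q != 0 by apply: contraNneq p_neq0 => q0; rewrite pE q0 mul0r.
have sz_p : size p = (size q).+1.
  by rewrite pE size_Mmonic ?monicXsubC // size_XsubC addn2.
apply: (@leq_trans (changes [seq Num.sg q.[w] | w <- ws] +
                    changes [seq Num.sg (w - z) | w <- ws])).
  apply: changes_map_le_add => x y qxy zxy.
  by rewrite pE !hornerM !hornerXsubC !sgrM qxy zxy.
by rewrite sz_p mulnS addnC leq_add ?changes_sgr_subr ?IH // -ltnS -sz_p.
Qed.

Lemma changes_sgr_determined (X : Type) (S : eqType) (w : X -> R) (f : X -> S)
    (ps : seq {poly R}) (s : seq X) : sorted <=%R (map w s) ->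
  (forall x y, [seq Num.sg p.[w x] | p <- ps] = [seq Num.sg p.[w y] | p <- ps] ->
     f x = f y) ->
  (changes (map f s) <= \sum_(p <- ps) 2 * size p)%N.
Proof.
move=> w_sorted f_det; apply: leq_trans (changes_map_le _ f_det) _.
elim: ps {f_det} => [|p ps IH] /=; first by rewrite changes_map_cst.
rewrite big_cons; apply: leq_trans (leq_add (changes_sgr_horner p w_sorted) IH).
by rewrite -map_comp; apply: changes_map_le_add => x y /= -> ->.
Qed.

End SignChanges.

(** * Vectors in space *)

Section DotProduct.
Variables (R : realFieldType) (n : nat).
Implicit Types (u v w : 'rV[R]_n) (c : R).

Definition dotmul u v : R := \sum_i u 0 i * v 0 i.

Local Notation "u *d v" := (dotmul u v) (at level 40).

Lemma dotmulC u v : u *d v = v *d u.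
Proof. by apply: eq_bigr => i _; rewrite mulrC. Qed.

Lemma dotmulDl u v w : (u + v) *d w = u *d w + v *d w.
Proof. by rewrite -big_split; apply: eq_bigr => i _; rewrite mxE mulrDl. Qed.

Lemma dotmulZl c u v : (c *: u) *d v = c * (u *d v).
Proof. by rewrite /dotmul mulr_sumr; apply: eq_bigr => i _; rewrite mxE mulrA. Qed.

Lemma dotmulNl u v : (- u) *d v = - (u *d v).
Proof. by rewrite -scaleN1r dotmulZl mulN1r. Qed.

Lemma dotmulBl u v w : (u - v) *d w = u *d w - v *d w.
Proof. by rewrite dotmulDl dotmulNl. Qed.

Lemma dotmulDr u v w : u *d (v + w) = u *d v + u *d w.
Proof. by rewrite !(dotmulC u) dotmulDl. Qed.

Lemma dotmulZr c u v : u *d (c *: v) = c * (u *d v).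
Proof. by rewrite !(dotmulC u) dotmulZl. Qed.

Lemma dotmulBr u v w : u *d (v - w) = u *d v - u *d w.
Proof. by rewrite !(dotmulC u) dotmulBl. Qed.

Lemma dotmul0r u : u *d 0 = 0.
Proof. by rewrite -(scale0r 0) dotmulZr mul0r. Qed.

Lemma dotmul_ge0 u : 0 <= u *d u.
Proof. by apply: sumr_ge0 => i _; exact: sqr_ge0. Qed.

Lemma dotmul_eq0 u : (u *d u == 0) = (u == 0).
Proof.
apply/eqP/eqP => [/psumr_eq0P u0|->]; last exact: dotmul0r.
apply/rowP => i; rewrite mxE; apply/eqP; rewrite -sqrf_eq0 expr2.
by rewrite u0 // => j _; exact: sqr_ge0.
Qed.

Lemma dotmul_gt0 u : (0 < u *d u) = (u != 0).
Proof. by rewrite lt_def dotmul_ge0 andbT dotmul_eq0. Qed.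

Lemma exists_nonroot (p : {poly R}) : p != 0 -> exists s, ~~ root p s.
Proof.
move=> p_neq0; apply/not_existsP => p_root.
have : (size [seq i%:R : R | i <- iota 0 (size p)] < size p)%N.
  apply: max_poly_roots => //; first by apply/allP => z _; apply/negPn/negP/p_root.
  by rewrite map_inj_uniq ?iota_uniq // => i j /eqP; rewrite eqr_nat => /eqP.
by rewrite size_map size_iota ltnn.
Qed.

Lemma horner_rVpoly_dotmul u (s : R) : (rVpoly u).[s] = (\row_i s ^+ i) *d u.
Proof. by rewrite horner_poly; apply: eq_bigr => i _; rewrite valK mxE mulrC. Qed.

(* A hyperplane through the origin meets the moment curve in finitely many points. *)
Lemma generic_functional (X : seq 'rV[R]_n) :
  exists k, {in X, forall x, x != 0 -> k *d x != 0}.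
Proof.
have [s] : exists s, ~~ root (\prod_(x <- X | x != 0) rVpoly x) s.
  apply: exists_nonroot; rewrite prodf_seq_neq0; apply/allP => x _; apply/implyP.
  by apply: contra_neq => x0; rewrite -(rVpolyK x) x0 linear0.
rewrite rootE horner_prod prodf_seq_neq0 => /allP sX.
exists (\row_i s ^+ i) => x /sX/implyP sx /sx; by rewrite horner_rVpoly_dotmul.
Qed.

End DotProduct.

Local Notation "u *d v" := (dotmul u v) (at level 40).
Local Notation "u *v v" := (crossmul u v) (at level 40).

Section CrossProduct.
Variable R : realType.
Implicit Types (u v w x y z : 'rV[R]_3) (a b c : R).

Lemma row3P u v : u 0 0 = v 0 0 -> u 0 1 = v 0 1 -> u 0 2 = v 0 2 -> u = v.
Proof.
move=> uv0 uv1 uv2; apply/rowP => -[[|[|[|//]]] lt_i3].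
- by rewrite (_ : Ordinal _ = 0) //; apply: val_inj.
- by rewrite (_ : Ordinal _ = 1) //; apply: val_inj.
- by rewrite (_ : Ordinal _ = 2) //; apply: val_inj.
Qed.

Lemma dotmul3E u v : u *d v = u 0 0 * v 0 0 + u 0 1 * v 0 1 + u 0 2 * v 0 2.
Proof.
rewrite /dotmul !big_ord_recl big_ord0 addr0 addrA.
by congr (_ + _ + _); congr (u 0 _ * v 0 _); apply: val_inj.
Qed.

Lemma crossmulE u v :
  ((u *v v) 0 0 = u 0 1 * v 0 2 - u 0 2 * v 0 1) *
  ((u *v v) 0 1 = u 0 2 * v 0 0 - u 0 0 * v 0 2) *
  ((u *v v) 0 2 = u 0 0 * v 0 1 - u 0 1 * v 0 0).
Proof.
have add1 : (0 + 1 = 1 :> 'I_3) * (1 + 1 = 2 :> 'I_3) * (2 + 1 = 0 :> 'I_3).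
  by do !split; apply: val_inj.
have add2 : (0 + 2 = 2 :> 'I_3) * (1 + 2 = 0 :> 'I_3) * (2 + 2 = 1 :> 'I_3).
  by do !split; apply: val_inj.
by do !split; rewrite mxE ?add1 ?add2.
Qed.

Lemma crossmul0l u : 0 *v u = 0.
Proof. by apply: row3P; rewrite crossmulE !mxE; ring. Qed.

Lemma crossmulxx u : u *v u = 0.
Proof. by apply: row3P; rewrite crossmulE !mxE; ring. Qed.

Lemma dotmul_crossmulA u v w : u *d (v *v w) = (u *v v) *d w.
Proof. by rewrite !dotmul3E !crossmulE; ring. Qed.

Lemma crossmul_crossmul u v w : (u *v v) *v w = (u *d w) *: v - (v *d w) *: u.
Proof. by apply: row3P; rewrite !crossmulE !dotmul3E !mxE; ring. Qed.

Lemma dotmul_crossmul2 u v w z :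
  (u *v v) *d (w *v z) = (u *d w) * (v *d z) - (u *d z) * (v *d w).
Proof. by rewrite !dotmul3E !crossmulE; ring. Qed.

(* The polar form of [x |-> sqarea x u]; the latter is the squared area of the
   parallelogram on [x] and [u]. *)
Definition area_form u x y := (x *v u) *d (y *v u).

Definition sqarea x u := area_form u x x.

Lemma area_formE u x y : area_form u x y = (x *d y) * (u *d u) - (x *d u) * (y *d u).
Proof. by rewrite /area_form dotmul_crossmul2 [u *d y]dotmulC. Qed.

Lemma sqareaE x u : sqarea x u = (x *d x) * (u *d u) - (x *d u) ^+ 2.
Proof. exact: area_formE. Qed.

Lemma area_formC u x y : area_form u x y = area_form u y x.
Proof. exact: dotmulC. Qed.

Lemma area_formDl u x y z : area_form u (x + y) z = area_form u x z + area_form u y z.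
Proof. by rewrite !area_formE !dotmulDl; ring. Qed.

Lemma area_formZl u c x y : area_form u (c *: x) y = c * area_form u x y.
Proof. by rewrite !area_formE !dotmulZl; ring. Qed.

Lemma sqareaC x u : sqarea x u = sqarea u x.
Proof. by rewrite !sqareaE (dotmulC u x); ring. Qed.

Lemma sqarea_ge0 x u : 0 <= sqarea x u.
Proof. exact: dotmul_ge0. Qed.

Lemma sqarea_gt0 x u : (0 < sqarea x u) = (sqarea x u != 0).
Proof. by rewrite lt_def sqarea_ge0 andbT. Qed.

Lemma sqareaxx x : sqarea x x = 0.
Proof. by rewrite sqareaE; ring. Qed.

Lemma sqarea0l x : sqarea 0 x = 0.
Proof. by rewrite sqareaE !(dotmulC 0) !dotmul0r mul0r expr0n subrr. Qed.

Lemma sqareaZl c x u : sqarea (c *: x) u = c ^+ 2 * sqarea x u.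
Proof. by rewrite /sqarea area_formZl area_formC area_formZl; ring. Qed.

Lemma sqareaDl x y u : sqarea (x + y) u = sqarea x u + 2 * area_form u x y + sqarea y u.
Proof.
by rewrite /sqarea area_formDl 2!(area_formC _ _ (x + y)) !area_formDl (area_formC u y); ring.
Qed.

Lemma sqarea_neq0 x y : sqarea x y != 0 -> (x != 0) /\ (y != 0).
Proof.
move=> xy; split; apply: contra_neq xy => ->; first exact: sqarea0l.
by rewrite sqareaC sqarea0l.
Qed.

Lemma sqarea_eq0P x u : u != 0 -> reflect (exists c, x = c *: u) (sqarea x u == 0).
Proof.
move=> u0; rewrite /sqarea /area_form dotmul_eq0; apply: (iffP eqP) => [xu0|[c ->]]; last first.
  by apply/eqP; rewrite -dotmul_eq0 -[_ *d _]/(sqarea _ _) sqareaZl sqareaxx mulr0.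
have uu0 : u *d u != 0 by rewrite dotmul_eq0.
exists (x *d u / (u *d u)); rewrite mulrC -scalerA; apply: (canRL (scalerK uu0)).
by apply/eqP; rewrite eq_sym -subr_eq0 -crossmul_crossmul xu0 crossmul0l.
Qed.

Lemma sqarea_eq0_trans x y u :
  u != 0 -> sqarea x u = 0 -> sqarea y u = 0 -> sqarea x y = 0.
Proof.
move=> u0 /eqP/(sqarea_eq0P _ u0)[b ->] /eqP/(sqarea_eq0P _ u0)[c ->].
by rewrite sqareaZl sqareaC sqareaZl sqareaxx !mulr0.
Qed.

Definition det3 x y z := x *d (y *v z).

Lemma cramer3 x y z w :
  det3 x y z *: w = det3 w y z *: x + det3 x w z *: y + det3 x y w *: z.
Proof. by apply: row3P; rewrite /det3 !dotmul3E !crossmulE !mxE; ring. Qed.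

Lemma orthogonal_expansion u v x : u *d v = 0 ->
  ((u *d u) * (v *d v)) *: x =
  ((v *d v) * (u *d x)) *: u + ((u *v v) *d x) *: (u *v v) + ((u *d u) * (v *d x)) *: v.
Proof.
move=> uv; apply/esym/eqP; rewrite -subr_eq0; apply/eqP.
transitivity ((u *d v) *: ((v *d x) *: u + (u *d x) *: v - (u *d v) *: x)).
  have := crossmulE u v; move: (u *v v) => w wE.
  by apply: row3P; rewrite !dotmul3E !mxE !wE; ring.
by rewrite uv scale0r.
Qed.

Lemma det3_neq0_ortho x y z w :
  det3 x y z != 0 -> x *d w = 0 -> y *d w = 0 -> z *d w = 0 -> w = 0.
Proof.
move=> xyz xw yw zw; apply/eqP; rewrite -dotmul_eq0 -(mulrI_eq0 _ (mulfI xyz)).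
by rewrite -dotmulZl cramer3 !dotmulDl !dotmulZl xw yw zw !mulr0 !addr0.
Qed.

End CrossProduct.

(** * At most four points are equidistant from three lines through the origin *)

Lemma definite_factorization (R : realFieldType) (a b c d p p' q q' : R) :
  0 < a -> 0 < a * b - c ^+ 2 ->
  a * d = p * p' -> b * d = q * q' -> 2 * c * d = p * q' + q * p' ->
  d = 0 /\ ((p = 0 /\ q = 0) \/ (p' = 0 /\ q' = 0)).
Proof.
move=> a_gt0 disc_gt0 ad bd cd; have d0 : d = 0.
  have [//|d_neq0] := eqVneq d 0.
  pose f := q ^+ 2 * a - 2 * p * q * c + p ^+ 2 * b.
  have f0 : f = 0.
    apply: (mulIf d_neq0); rewrite mul0r.
    transitivity (q ^+ 2 * (a * d) - p * q * (2 * c * d) + p ^+ 2 * (b * d)).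
      by rewrite /f; ring.
    by rewrite ad bd cd; ring.
  have : (a * q - c * p) ^+ 2 + (a * b - c ^+ 2) * p ^+ 2 = 0.
    by rewrite -(mulr0 a) -f0 /f; ring.
  have := sqr_ge0 (a * q - c * p); have := sqr_ge0 p => p2 aq2 fE.
  have /eqP : p ^+ 2 = 0 by nra.
  rewrite sqrf_eq0 => /eqP p0; move/eqP: ad.
  by rewrite p0 mul0r mulf_eq0 gt_eqF // => /eqP.
split=> //; move: ad bd cd; rewrite d0 !mulr0 => /esym/eqP + /esym/eqP + /esym.
rewrite !mulf_eq0 => /orP[]/eqP -> /orP[]/eqP -> /eqP; rewrite ?mul0r ?mulr0 ?addr0 ?add0r.
- by move=> _; left.
- by rewrite mulf_eq0 => /orP[]/eqP ->; [left|right].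
- by rewrite mulf_eq0 => /orP[]/eqP ->; [left|right].
- by move=> _; right.
Qed.

Section Planes.
Variable R : realType.
Implicit Types (u v n w z : 'rV[R]_3).

Definition mirror n u := u - (2 * (n *d u) / (n *d n)) *: n.

Variables x y : 'rV[R]_3.
Hypothesis xy : sqarea x y != 0.

Let normal := x *v y.

Let normal_gt0 : 0 < normal *d normal.
Proof. by rewrite [_ < _]sqarea_gt0. Qed.

Lemma orthogonal_plane z : x *d z = 0 -> y *d z = 0 -> exists c, z = c *: normal.
Proof.
move=> xz yz; apply/sqarea_eq0P; first by rewrite -dotmul_gt0.
rewrite sqareaC /sqarea /area_form crossmul_crossmul xz yz !scale0r subrr.
by rewrite dotmul0r.
Qed.

Lemma in_plane z : det3 x y z = 0 -> exists a b, z = a *: x + b *: y.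
Proof.
move=> xyz; have nn := lt0r_neq0 normal_gt0.
exists (det3 z y normal / (normal *d normal)), (det3 x z normal / (normal *d normal)).
apply: (scalerI nn); rewrite scalerDr !scalerA !(mulrCA (normal *d normal)).
rewrite divff // !mulr1 -[RHS]addr0 -(scale0r normal) -xyz -cramer3.
by rewrite /det3 dotmul_crossmulA.
Qed.

(* The difference of the two forms is [w |-> |w|^2 (|u|^2 - |v|^2) -
   (w . (u - v)) (w . (u + v))]; it vanishes on the plane, so [|u| = |v|] and one
   of [u - v], [u + v] is orthogonal to the plane. *)
Lemma area_form_eq_on_plane u v : sqarea u v != 0 ->
  sqarea x u = sqarea x v -> sqarea y u = sqarea y v ->
  area_form u x y = area_form v x y -> exists e : R, v = e *: mirror normal u.
Proof.
move=> uv; rewrite !sqareaE !area_formE => xuv yuv xyuv.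
have [uvE ortho] : u *d u - v *d v = 0 /\
    ((x *d (u - v) = 0 /\ y *d (u - v) = 0) \/ (x *d (u + v) = 0 /\ y *d (u + v) = 0)).
  apply: (@definite_factorization _ (x *d x) (y *d y) (x *d y)).
  - by rewrite dotmul_gt0; have [] := sqarea_neq0 xy.
  - by rewrite -sqareaE sqarea_gt0.
  - by rewrite dotmulBr dotmulDr mulrBr; move: xuv; lra.
  - by rewrite dotmulBr dotmulDr mulrBr; move: yuv; lra.
  - by rewrite !dotmulBr !dotmulDr mulrBr; move: xyuv; lra.
have [e [e2 [c uE]]] : exists e : R, e ^+ 2 = 1 /\ exists c, u - e *: v = c *: normal.
  case: ortho => -[xuv0 yuv0]; [exists 1 | exists (-1)]; rewrite ?sqrrN expr1n; split=> //.
    by apply: orthogonal_plane; rewrite scale1r.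
  by apply: orthogonal_plane; rewrite scaleN1r opprK.
have evE : e *: v = u - c *: normal by rewrite -uE opprB addrC subrK.
have vE : v = e *: (u - c *: normal) by rewrite -evE scalerA -expr2 e2 scale1r.
have c_neq0 : c != 0.
  by apply: contra_neq uv => c0; rewrite vE c0 scale0r subr0 sqareaC sqareaZl sqareaxx mulr0.
suff cE : 2 * (normal *d u) / (normal *d normal) = c by exists e; rewrite /mirror cE.
apply: (mulfI c_neq0); apply: (mulIf (lt0r_neq0 normal_gt0)).
rewrite -[LHS]mulrA divfK ?lt0r_neq0 //.
have : v *d v = (u - c *: normal) *d (u - c *: normal).
  by rewrite vE dotmulZl dotmulZr mulrA -expr2 e2 mul1r.
rewrite !(dotmulBl, dotmulBr, dotmulZl, dotmulZr) (dotmulC u normal).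
by move: uvE; lra.
Qed.

End Planes.

Section Conics.
Variables (R : realType) (f : 'rV[R]_3 -> 'rV[R]_3 -> R).
Hypothesis fC : forall x y, f x y = f y x.
Hypothesis fDl : forall x y z, f (x + y) z = f x z + f y z.
Hypothesis fZl : forall c x y, f (c *: x) y = c * f x y.

(* The conic [f z z = 0] contains the line through [x1] and [x2], hence its other
   component is a line through [x3], [x4] and [x5]. *)
Lemma conic_line_three_points x1 x2 x3 x4 x5 :
  det3 x1 x2 x3 != 0 -> det3 x1 x2 x4 != 0 -> det3 x1 x2 x5 != 0 -> det3 x3 x4 x5 != 0 ->
  {in [:: x1; x2; x3; x4; x5], forall x, f x x = 0} -> f x1 x2 = 0 ->
  forall z, f z z = 0.
Proof.
move=> x123 x124 x125 x345 f0 f12.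
pose l := f x1 x3 *: (x2 *v x3) + f x2 x3 *: (x3 *v x1).
have fE z : det3 x1 x2 x3 ^+ 2 * f z z = 2 * det3 x1 x2 z * (z *d l).
  transitivity (f (det3 x1 x2 x3 *: z) (det3 x1 x2 x3 *: z)).
    by rewrite fZl fC fZl expr2 mulrA.
  rewrite cramer3; set p := _ + _; rewrite /p !(fDl, fZl) ![f _ p]fC /p !(fDl, fZl).
  rewrite !(fC x2 x1) !(fC x3) f12 !f0 ?inE ?eqxx ?orbT //.
  by rewrite /l dotmulDr !dotmulZr /det3 (dotmul3E x1) !dotmul3E !crossmulE; ring.
have l_ortho z : z \in [:: x3; x4; x5] -> det3 x1 x2 z != 0 -> z *d l = 0.
  move=> z345 x12z; have := fE z; rewrite f0; last by rewrite 2!in_cons z345 !orbT.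
  by rewrite mulr0 => /esym/eqP; rewrite !mulf_eq0 pnatr_eq0 (negPf x12z) => /eqP.
have l0 : l = 0.
  by apply: (det3_neq0_ortho x345); apply: l_ortho; rewrite ?inE ?eqxx ?orbT.
by move=> z; apply: (mulfI (expf_neq0 2 x123)); rewrite fE l0 dotmul0r !mulr0.
Qed.

End Conics.

Lemma pencil_trivial (R : realFieldType) (m n p q s : R) : 0 < p -> 0 < q -> 0 < s ->
  m * p + n * q = 0 -> n * (s - p) = m * p -> m * (s - q) = n * q -> m = 0 /\ n = 0.
Proof.
move=> p_gt0 q_gt0 s_gt0 pqE spE sqE.
have /eqP : n * (s + q - p) = 0 by lra.
have /eqP : m * (s + p - q) = 0 by lra.
rewrite !mulf_eq0 => /orP[]/eqP m0 /orP[]/eqP n0; first by split.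
- by split=> //; apply: (mulIf (lt0r_neq0 q_gt0)); move: pqE; rewrite m0; lra.
- by split=> //; apply: (mulIf (lt0r_neq0 p_gt0)); move: pqE; rewrite n0; lra.
- by exfalso; lra.
Qed.

Section Tied.
Variables (R : realType) (u0 a b : 'rV[R]_3).
Hypotheses (u0a : sqarea u0 a != 0) (u0b : sqarea u0 b != 0) (ab : sqarea a b != 0).
Implicit Types x y z : 'rV[R]_3.

Definition tied x := (sqarea x a == sqarea x u0) && (sqarea x b == sqarea x u0).

Lemma tied_plane x y : tied x -> tied y -> sqarea x y != 0 ->
  ~ (area_form a x y = area_form u0 x y /\ area_form b x y = area_form u0 x y).
Proof.
move=> /andP[/eqP xa /eqP xb] /andP[/eqP ya /eqP yb] xy [xya xyb].
have [e aE] := area_form_eq_on_plane xy u0a (esym xa) (esym ya) (esym xya).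
have [f bE] := area_form_eq_on_plane xy u0b (esym xb) (esym yb) (esym xyb).
by move: ab; rewrite aE bE sqareaZl sqareaC sqareaZl sqareaxx !mulr0 eqxx.
Qed.

Lemma tied_det3 x y z : tied x -> tied y -> tied z ->
  sqarea x y != 0 -> sqarea y z != 0 -> sqarea x z != 0 -> det3 x y z != 0.
Proof.
move=> tx ty tz xy yz xz; apply/eqP => /(in_plane xy)[c [d zE]].
have c_neq0 : c != 0.
  by apply: contra_neq yz => c0; rewrite zE c0 scale0r add0r sqareaC sqareaZl sqareaxx mulr0.
have d_neq0 : d != 0.
  by apply: contra_neq xz => d0; rewrite zE d0 scale0r addr0 sqareaC sqareaZl sqareaxx mulr0.
have cd_neq0 : 2 * (c * d) != 0 by rewrite !mulf_neq0 ?pnatr_eq0.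
have formE u : sqarea x u = sqarea x u0 -> sqarea y u = sqarea y u0 ->
    sqarea z u = sqarea z u0 -> area_form u x y = area_form u0 x y.
  rewrite zE !sqareaDl !sqareaZl !area_formZl !(area_formC _ x) !area_formZl => -> -> zu.
  by apply: (mulfI cd_neq0); move: zu; lra.
case/andP: (tx) (ty) (tz) => /eqP xa /eqP xb /andP[/eqP ya /eqP yb] /andP[/eqP za /eqP zb].
by apply: (tied_plane tx ty xy); split; apply: formE.
Qed.

(* Some nonzero combination of [area_form a - area_form u0] and
   [area_form b - area_form u0] also vanishes at [(x1, x2)], so it is zero. *)
Lemma no_five_tied x1 x2 x3 x4 x5 :
  pairwise (fun x y => sqarea x y != 0) [:: x1; x2; x3; x4; x5] ->
  ~~ all tied [:: x1; x2; x3; x4; x5].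
Proof.
move=> /= /and5P[/and5P[x12 x13 x14 x15 _] /and4P[x23 x24 x25 _] /and3P[x34 x35 _]].
move=> /andP[x45 _] _; apply/negP => /and5P[t1 t2 t3 t4 /andP[t5 _]].
pose m := area_form b x1 x2 - area_form u0 x1 x2.
pose n := area_form u0 x1 x2 - area_form a x1 x2.
pose f x y := m * (area_form a x y - area_form u0 x y) +
              n * (area_form b x y - area_form u0 x y).
have f_tied x : tied x -> f x x = 0.
  by move=> /andP[/eqP xa /eqP xb]; rewrite /f -!/(sqarea _ _) xa xb !subrr !mulr0 addr0.
have f0 z : f z z = 0.
  have fC x y : f x y = f y x by rewrite /f !(area_formC _ x y).
  have fDl x y w : f (x + y) w = f x w + f y w by rewrite /f !area_formDl; ring.
  have fZl c x y : f (c *: x) y = c * f x y by rewrite /f !area_formZl; ring.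
  apply: (conic_line_three_points fC fDl fZl (tied_det3 t1 t2 t3 x12 x23 x13)
    (tied_det3 t1 t2 t4 x12 x24 x14) (tied_det3 t1 t2 t5 x12 x25 x15)
    (tied_det3 t3 t4 t5 x34 x45 x35)); last by rewrite /f /m /n; ring.
  by move=> x; rewrite !inE => /or4P[|||/orP[]] /eqP ->; exact: f_tied.
have [m0 n0] : m = 0 /\ n = 0.
  apply: (@pencil_trivial _ _ _ (sqarea u0 a) (sqarea u0 b) (sqarea a b));
    rewrite ?sqarea_gt0 //.
  - by have := f0 u0; rewrite /f -!/(sqarea _ _) sqareaxx !subr0.
  - by have := f0 a; rewrite /f -!/(sqarea _ _) sqareaxx !(sqareaC a u0); lra.
  - by have := f0 b; rewrite /f -!/(sqarea _ _) sqareaxx !(sqareaC b); lra.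
by apply: (tied_plane t1 t2 x12); move: m0 n0; rewrite /m /n; split; lra.
Qed.

Lemma size_tied_le4 (xs : seq 'rV[R]_3) : uniq xs ->
  {in xs &, forall x y, x != y -> sqarea x y != 0} -> all tied xs -> (size xs <= 4)%N.
Proof.
move=> xs_uniq xs_area xs_tied; rewrite leqNgt; apply/negP => sz_xs.
have xs5 : take 5 xs = [:: xs`_0; xs`_1; xs`_2; xs`_3; xs`_4].
  by case: xs sz_xs {xs_uniq xs_area xs_tied} => [|x1 [|x2 [|x3 [|x4 [|x5 xs]]]]] //=;
    rewrite take0.
have xs5_tied : all tied (take 5 xs) by apply/allP => x /mem_take/(allP xs_tied).
have : pairwise (fun x y => sqarea x y != 0) (take 5 xs).
  have := take_uniq 5 xs_uniq; rewrite uniq_pairwise.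
  apply: (sub_in_pairwise (P := mem xs)); first by move=> x y xxs yxs; exact: xs_area.
  by apply/allP => x /mem_take.
by rewrite xs5 => /no_five_tied/negP[]; rewrite -xs5.
Qed.

End Tied.

(** * Sweeping around an axis *)

Section SquareComparisons.
Variable R : rcfType.
Implicit Types s t l d y : R.

Lemma ler_sqr_sqrt y d :
  (y ^+ 2 <= d) = (0 <= d) && ((- Num.sqrt d <= y) && (- Num.sqrt d <= - y)).
Proof.
have [d_ge0|d_lt0] := leP 0 d; last by apply/negbTE; rewrite -ltNge (lt_le_trans d_lt0) ?sqr_ge0.
rewrite -{1}(sqr_sqrtr d_ge0) -real_normK ?num_real // ler_sqr ?nnegrE ?sqrtr_ge0 //.
by rewrite ler_norml lerN2.
Qed.

Lemma eqr_sqr_sqrt y d :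
  (y ^+ 2 == d) = (0 <= d) && ((- Num.sqrt d == y) || (- Num.sqrt d == - y)).
Proof.
have [d_ge0|d_lt0] := leP 0 d; last by rewrite gt_eqF // (lt_le_trans d_lt0) ?sqr_ge0.
by rewrite -{1}(sqr_sqrtr d_ge0) eqf_sqr eqr_opp orbC !(eq_sym y).
Qed.

(* The right-hand side only involves signs of polynomials in [l], [s ^+ 2] and
   [t ^+ 2]. *)
Lemma ler_add_squares l s t (g := t ^+ 2 - s ^+ 2 - l ^+ 2)
    (h := 4 * l ^+ 2 * s ^+ 2 - g ^+ 2) : 0 <= s -> 0 <= t ->
  (t <= l + s) = ((0 <= l) || (0 <= s ^+ 2 - l ^+ 2)) &&
    (if 0 <= l then (g <= 0) || (0 <= h) else (g <= 0) && (h <= 0)).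
Proof.
move=> s_ge0 t_ge0.
have gE : (l + s) ^+ 2 - t ^+ 2 = 2 * l * s - g by rewrite /g; ring.
have hE : h = (2 * l * s - g) * (2 * l * s + g) by rewrite /h; ring.
have le_sqr : 0 <= l + s -> (t <= l + s) = (0 <= 2 * l * s - g).
  by move=> ls_ge0; rewrite -gE subr_ge0 ler_sqr ?nnegrE.
rewrite {}hE; have [l_ge0|l_lt0] := leP 0 l => /=.
  rewrite le_sqr; last by lra.
  have ls_ge0 : 0 <= 2 * l * s by rewrite !mulr_ge0.
  have [g_le0|g_gt0] := leP g 0 => /=; first by apply/idP; lra.
  by rewrite pmulr_lge0 //; lra.
have ls_le0 : 2 * l * s <= 0 by nra.
have -> : (0 <= s ^+ 2 - l ^+ 2) = (0 <= l + s).
  have -> : s ^+ 2 - l ^+ 2 = (l + s) * (s - l) by ring.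
  by rewrite pmulr_lge0 //; lra.
have [ls_ge0|ls_lt0] := leP 0 (l + s) => /=; last by apply/negbTE; rewrite -ltNge; lra.
rewrite le_sqr //; have [g_le0|g_gt0] := leP g 0 => /=; last first.
  by apply/negbTE; rewrite -ltNge; lra.
have [lsg0|lsg_neq0] := eqVneq (2 * l * s + g) 0; first by rewrite lsg0 mulr0 lexx; apply/idP; lra.
by rewrite nmulr_lle0 // lt_neqAle lsg_neq0; lra.
Qed.

Lemma sgr_eq_ge0 s t : Num.sg s = Num.sg t -> (0 <= s) = (0 <= t).
Proof. by move=> st; rewrite -[LHS]sgr_ge0 st sgr_ge0. Qed.

Lemma sgr_eq_le0 s t : Num.sg s = Num.sg t -> (s <= 0) = (t <= 0).
Proof. by move=> st; rewrite -[LHS]sgr_le0 st sgr_le0. Qed.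

Lemma size_polyB_le (p q : {poly R}) n :
  (size p <= n)%N -> (size q <= n)%N -> (size (p - q)%R <= n)%N.
Proof.
by move=> szp szq; rewrite (leq_trans (size_polyD _ _)) // size_polyN geq_max szp.
Qed.

Lemma size_polyM_le (p q : {poly R}) m n :
  (size p <= m.+1)%N -> (size q <= n)%N -> (size (p * q)%R <= m + n)%N.
Proof. by move=> szp szq; apply: leq_trans (size_polyMleq _ _) _; lia. Qed.

End SquareComparisons.

Lemma generic_normal (R : realType) (X : seq 'rV[R]_3) (u0 : 'rV[R]_3) :
  exists k, k *d u0 = 0 /\ {in X, forall x, sqarea x u0 != 0 -> k *d x != 0}.
Proof.
have [k k_generic] := generic_functional [seq u0 *v x | x <- X].
exists (k *v u0); split; first by rewrite -dotmul_crossmulA crossmulxx dotmul0r.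
move=> x xX xu0; rewrite -dotmul_crossmulA; apply: k_generic; first exact: map_f.
by rewrite -dotmul_eq0 -[_ *d _]/(sqarea u0 x) sqareaC.
Qed.

Section Sweep.
Variables (R : realType) (X : seq 'rV[R]_3) (u0 : 'rV[R]_3).
Implicit Types (x u a b : 'rV[R]_3) (z h : R).

Definition sweep_normal : 'rV[R]_3 := projT1 (cid (generic_normal X u0)).

Local Notation k := sweep_normal.
Local Notation e := (k *v u0).

Lemma sweep_normal_ortho : k *d u0 = 0.
Proof. by have [] := projT2 (cid (generic_normal X u0)). Qed.

(* Up to a factor, [x] is [k + slope x *: e + height x *: u0]: the slope names
   the generating line of [x] and the height its position there. *)
Definition slope x := (e *d x) / ((u0 *d u0) * (k *d x)).
Definition height x := (k *d k) * (u0 *d x) / ((u0 *d u0) * (k *d x)).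
Definition ray z h := k + z *: e + h *: u0.

Definition sweep := sort (relpre slope <=%R) [seq x <- X | sqarea x u0 != 0].

Lemma perm_sweep : perm_eq sweep [seq x <- X | sqarea x u0 != 0].
Proof. by rewrite perm_sort. Qed.

Lemma mem_sweep x : (x \in sweep) = (sqarea x u0 != 0) && (x \in X).
Proof. by rewrite mem_sort mem_filter. Qed.

Lemma sweep_normal_neq0 x : x \in sweep -> k *d x != 0.
Proof.
rewrite mem_sweep => /andP[xu0 xX].
by have [_ k_generic] := projT2 (cid (generic_normal X u0)); exact: k_generic.
Qed.

Lemma sweep_ray x : x \in sweep -> x = (k *d x / (k *d k)) *: ray (slope x) (height x).
Proof.
move=> xs; have kx := sweep_normal_neq0 xs.
have k_neq0 : k *d k != 0.
  by rewrite dotmul_eq0; apply: contra_neq kx => k0; rewrite dotmulC k0 dotmul0r.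
have u0_neq0 : u0 *d u0 != 0.
  by rewrite dotmul_eq0; move: xs; rewrite mem_sweep => /andP[/sqarea_neq0[]].
apply: (scalerI (mulf_neq0 k_neq0 u0_neq0)); rewrite orthogonal_expansion ?sweep_normal_ortho //.
rewrite /ray /slope /height !scalerDr !scalerA.
by congr (_ *: _ + _ *: _ + _ *: _); field; rewrite ?kx ?k_neq0 ?u0_neq0.
Qed.

Definition half_linear_coef u : {poly R} := Poly [:: area_form u k u0; area_form u e u0].

Definition constant_coef u : {poly R} :=
  Poly [:: sqarea k u - sqarea k u0; 2 * (area_form u k e - area_form u0 k e);
           sqarea e u - sqarea e u0].

Definition discriminant u : {poly R} :=
  half_linear_coef u ^+ 2 - (sqarea u0 u)%:P * constant_coef u.

Lemma size_half_linear_coef u : (size (half_linear_coef u) <= 2)%N.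
Proof. exact: size_Poly. Qed.

Lemma size_discriminant u : (size (discriminant u) <= 3)%N.
Proof.
apply: size_polyB_le.
  by rewrite expr2 (@size_polyM_le _ _ _ 1 2) ?size_half_linear_coef.
by apply: (@size_polyM_le _ _ _ 0 3); [exact: size_polyC_leq1 | exact: size_Poly].
Qed.

Lemma sqareaB_ray u z h : sqarea (ray z h) u - sqarea (ray z h) u0 =
  sqarea u0 u * h ^+ 2 + 2 * (half_linear_coef u).[z] * h + (constant_coef u).[z].
Proof.
have u0E x : area_form u0 x u0 = 0.
  by rewrite area_formE; ring.
rewrite /ray !sqareaDl !sqareaZl !area_formDl !area_formZl.
rewrite !(area_formC _ _ (_ *: _)) !area_formZl !(area_formC _ u0) !u0E sqareaxx.
by rewrite !horner_Poly /= ![area_form _ e k]area_formC; ring.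
Qed.

Definition offset u x := sqarea u0 u * height x + (half_linear_coef u).[slope x].

Lemma complete_square x u : x \in sweep -> sqarea u u0 != 0 -> exists2 c, 0 < c &
  c * (sqarea x u - sqarea x u0) = offset u x ^+ 2 - (discriminant u).[slope x].
Proof.
move=> xs; rewrite sqareaC -sqarea_gt0 => u_gt0; pose c := k *d x / (k *d k).
have xE v : sqarea x v = c ^+ 2 * sqarea (ray (slope x) (height x)) v.
  by rewrite {1}(sweep_ray xs) sqareaZl.
have c_neq0 : c != 0.
  move: xs; rewrite mem_sweep => /andP[+ _]; rewrite xE; apply: contra_neq => ->.
  by rewrite expr0n mul0r.
exists (sqarea u0 u / c ^+ 2); first by rewrite divr_gt0 // exprn_even_gt0.
rewrite !xE -mulrBr mulrA divfK ?expf_neq0 // sqareaB_ray /offset.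
by rewrite [(discriminant u).[_]]hornerD horner_exp hornerN hornerM hornerC; ring.
Qed.

(* The cylinder of [u] imposes on the height of [x] a lower bound (side [false])
   and an upper bound (side [true]); [endpoint] is this bound, negated on side
   [true], when the line of slope [z] meets the cylinder. *)
Implicit Type s : bool.

Definition endpoint s u z :=
  (- ((-1) ^+ s * (half_linear_coef u).[z]) - Num.sqrt (discriminant u).[z]) / sqarea u0 u.

Definition within s u x := (0 <= (discriminant u).[slope x]) &&
  (endpoint s u (slope x) <= (-1) ^+ s * height x).

Definition touches s u x := (0 <= (discriminant u).[slope x]) &&
  (endpoint s u (slope x) == (-1) ^+ s * height x).

Definition tighter s a b x := ((discriminant a).[slope x] < 0) ||
  (0 <= (discriminant b).[slope x]) && (endpoint s b (slope x) <= endpoint s a (slope x)).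

Lemma withinE s u x : sqarea u u0 != 0 -> within s u x =
  (0 <= (discriminant u).[slope x]) &&
  (- Num.sqrt (discriminant u).[slope x] <= (-1) ^+ s * offset u x).
Proof.
rewrite sqareaC -sqarea_gt0 => u_gt0; rewrite /within ler_pdivrMr // /offset mulrDr.
by congr (_ && _); rewrite lerBlDl -lerBlDr; apply/idP/idP; lra.
Qed.

Lemma touchesE s u x : sqarea u u0 != 0 -> touches s u x =
  (0 <= (discriminant u).[slope x]) &&
  (- Num.sqrt (discriminant u).[slope x] == (-1) ^+ s * offset u x).
Proof.
rewrite sqareaC => u_neq0; rewrite /touches -(inj_eq (mulIf u_neq0)) divfK // /offset mulrDr.
by congr (_ && _); apply/eqP/eqP; lra.
Qed.

Lemma within_sides x u : x \in sweep -> sqarea u u0 != 0 ->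
  (sqarea x u <= sqarea x u0) = within false u x && within true u x.
Proof.
move=> xs uu0; have [c c_gt0 cE] := complete_square xs uu0.
rewrite -subr_le0 -(pmulr_rle0 _ c_gt0) cE subr_le0 ler_sqr_sqrt !withinE //.
by rewrite mul1r mulN1r; case: (0 <= _).
Qed.

Lemma touches_sides x u : x \in sweep -> sqarea u u0 != 0 ->
  (sqarea x u == sqarea x u0) = touches false u x || touches true u x.
Proof.
move=> xs uu0; have [c c_gt0 cE] := complete_square xs uu0.
rewrite -subr_eq0 -(mulrI_eq0 _ (mulfI (lt0r_neq0 c_gt0))) cE subr_eq0 eqr_sqr_sqrt.
by rewrite !touchesE // mul1r mulN1r; case: (0 <= _).
Qed.

Lemma touches_sqarea s x u : x \in sweep -> sqarea u u0 != 0 ->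
  touches s u x -> sqarea x u == sqarea x u0.
Proof. by move=> xs uu0; rewrite touches_sides //; case: s => ->; rewrite ?orbT. Qed.

Lemma tighter_total s a b x : tighter s a b x || tighter s b a x.
Proof. by rewrite /tighter; case: ltP => //= _; case: ltP => //= _; exact: le_total. Qed.

Lemma tighter_trans s a b c x : tighter s a b x -> tighter s b c x -> tighter s a c x.
Proof.
rewrite /tighter; case: ltP => //= _ /andP[b_ge0 ab].
by rewrite ltNge b_ge0 /= => /andP[-> /le_trans]; apply.
Qed.

Lemma tighter_within s a b x : tighter s a b x -> within s a x -> within s b x.
Proof. by rewrite /tighter /within; case: ltP => //= _ /andP[-> /le_trans]; apply. Qed.

Lemma touches_tighter s a b x : touches s a x -> within s b x -> tighter s a b x.
Proof.
by rewrite /touches /within /tighter => /andP[_ /eqP->] /andP[-> ->]; rewrite orbT.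
Qed.

Lemma touches_tie s a b x :
  touches s a x -> within s b x -> tighter s b a x -> touches s b x.
Proof.
rewrite /touches /within /tighter => /andP[a_ge0 /eqP aE] /andP[b_ge0 le_b].
by rewrite ltNge b_ge0 a_ge0 /= aE eq_le le_b.
Qed.

Definition envelope_order : nat := 38.

Section ComparePolynomials.
Variables (s : bool) (a b : 'rV[R]_3).

Definition cmp_lin : {poly R} := (-1) ^+ s *:
  ((sqarea u0 a)%:P * half_linear_coef b - (sqarea u0 b)%:P * half_linear_coef a).
Definition cmp_left : {poly R} := (sqarea u0 b ^+ 2)%:P * discriminant a.
Definition cmp_right : {poly R} := (sqarea u0 a ^+ 2)%:P * discriminant b.
Definition cmp_gap : {poly R} := cmp_left - cmp_right - cmp_lin ^+ 2.
Definition cmp_resolvent : {poly R} := 4%:P * cmp_lin ^+ 2 * cmp_right - cmp_gap ^+ 2.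
Definition cmp_polys : seq {poly R} :=
  [:: discriminant a; discriminant b; cmp_lin; cmp_right - cmp_lin ^+ 2; cmp_gap;
      cmp_resolvent].

Lemma ler_endpointE z : sqarea a u0 != 0 -> sqarea b u0 != 0 ->
  0 <= (discriminant a).[z] -> 0 <= (discriminant b).[z] ->
  (endpoint s b z <= endpoint s a z) =
    ((0 <= cmp_lin.[z]) || (0 <= (cmp_right - cmp_lin ^+ 2).[z])) &&
    (if 0 <= cmp_lin.[z] then (cmp_gap.[z] <= 0) || (0 <= cmp_resolvent.[z])
     else (cmp_gap.[z] <= 0) && (cmp_resolvent.[z] <= 0)).
Proof.
rewrite ![sqarea _ u0]sqareaC -!sqarea_gt0 => a_gt0 b_gt0 da_ge0 db_ge0.
pose sa := sqarea u0 a * Num.sqrt (discriminant b).[z].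
pose sb := sqarea u0 b * Num.sqrt (discriminant a).[z].
have rightE : cmp_right.[z] = sa ^+ 2 by rewrite exprMn sqr_sqrtr // hornerM hornerC.
have leftE : cmp_left.[z] = sb ^+ 2 by rewrite exprMn sqr_sqrtr // hornerM hornerC.
have lin2E : (cmp_lin ^+ 2).[z] = cmp_lin.[z] ^+ 2 by rewrite horner_exp.
have gapE : cmp_gap.[z] = sb ^+ 2 - sa ^+ 2 - cmp_lin.[z] ^+ 2.
  by rewrite -leftE -rightE -lin2E !hornerD !hornerN.
have resE : cmp_resolvent.[z] = 4 * cmp_lin.[z] ^+ 2 * sa ^+ 2 - cmp_gap.[z] ^+ 2.
  by rewrite -rightE hornerD hornerN horner_exp 2!hornerM hornerC lin2E.
rewrite resE gapE [(_ - _).[z]]hornerD hornerN rightE lin2E.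
rewrite -ler_add_squares ?mulr_ge0 ?sqrtr_ge0 ?(ltW a_gt0) ?(ltW b_gt0) //.
have -> : cmp_lin.[z] = (-1) ^+ s * (sqarea u0 a * (half_linear_coef b).[z] -
    sqarea u0 b * (half_linear_coef a).[z]).
  by rewrite hornerZ hornerD hornerN !hornerM !hornerC.
rewrite /endpoint ler_pdivrMr // mulrAC ler_pdivlMr // /sa /sb.
by apply/idP/idP; lra.
Qed.

Lemma size_cmp_polys : (\sum_(p <- cmp_polys) 2 * size p <= envelope_order)%N.
Proof.
have size_scaled (c : R) (p : {poly R}) n : (size p <= n)%N -> (size (c%:P * p)%R <= n)%N.
  by rewrite mul_polyC; exact: leq_trans (size_scale_leq _ _).
have sz_lin : (size cmp_lin <= 2)%N.
  apply: leq_trans (size_scale_leq _ _) _.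
  by apply: size_polyB_le; rewrite size_scaled ?size_half_linear_coef.
have sz_lin2 : (size (cmp_lin ^+ 2)%R <= 3)%N by rewrite expr2 (@size_polyM_le _ _ _ 1 2).
have sz_left : (size cmp_left <= 3)%N by rewrite size_scaled ?size_discriminant.
have sz_right : (size cmp_right <= 3)%N by rewrite size_scaled ?size_discriminant.
have sz_gap : (size cmp_gap <= 3)%N by rewrite !size_polyB_le.
have sz_res : (size cmp_resolvent <= 5)%N.
  apply: size_polyB_le; last by rewrite expr2 (@size_polyM_le _ _ _ 2 3).
  by apply: (@size_polyM_le _ _ _ 2 3) => //; exact: size_scaled.
have sz_diff : (size (cmp_right - cmp_lin ^+ 2)%R <= 3)%N by rewrite size_polyB_le.
rewrite /cmp_polys /envelope_order !big_cons big_nil.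
have := size_discriminant a; have := size_discriminant b.
by move: sz_lin sz_diff sz_gap sz_res; lia.
Qed.

Lemma changes_tighter : sqarea a u0 != 0 -> sqarea b u0 != 0 ->
  (changes (map (tighter s a b) sweep) <= envelope_order)%N.
Proof.
move=> au0 bu0; apply: leq_trans size_cmp_polys.
apply: (@changes_sgr_determined _ _ _ slope).
  by rewrite sorted_map; apply: sort_sorted => x y; exact: le_total.
move=> x y /= [da db lin diff gap res].
rewrite /tighter !(ltNge _ 0) (sgr_eq_ge0 da) (sgr_eq_ge0 db).
have [da_ge0|//] := leP 0 (discriminant a).[slope y].
have [db_ge0|//] := leP 0 (discriminant b).[slope y] => /=.
rewrite !ler_endpointE ?(sgr_eq_ge0 da) ?(sgr_eq_ge0 db) // (sgr_eq_ge0 lin).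
by rewrite (sgr_eq_ge0 diff) (sgr_eq_le0 gap) (sgr_eq_ge0 res) (sgr_eq_le0 res).
Qed.

End ComparePolynomials.

End Sweep.

(** * Incidences on one cylinder *)

Lemma sumr_const_seq (R : pzRingType) (I : Type) (s : seq I) (c : R) :
  \sum_(i <- s) c = (size s)%:R * c.
Proof. by rewrite big_const_seq count_predT iter_addr_0 mulr_natl. Qed.

Lemma exchange_count (I J : Type) (r : I -> J -> bool) (s : seq I) (t : seq J) :
  (\sum_(i <- s) count (r i) t = \sum_(j <- t) count (r^~ j) s)%N.
Proof.
under eq_bigr do rewrite -sum1_count big_mkcond /=.
rewrite exchange_big /=; apply: eq_bigr => j _.
by rewrite -sum1_count [RHS]big_mkcond.
Qed.

Lemma sqr_sum_le (R : realDomainType) (I : Type) (s : seq I) (f : I -> R) :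
  (\sum_(i <- s) f i) ^+ 2 <= (size s)%:R * \sum_(i <- s) f i ^+ 2.
Proof.
elim: s => [|i s IH]; first by rewrite !big_nil mulr0 expr0n.
rewrite !big_cons /= -natr1; have [|s_gt0] := posnP (size s).
  by move/size0nil=> ->; rewrite !big_nil !addr0 add0r mul1r.
have n_gt0 : 0 < (size s)%:R :> R by rewrite ltr0n.
move: (\sum_(j <- s) f j) (\sum_(j <- s) f j ^+ 2) (size s)%:R n_gt0 IH => a b n n_gt0 IH.
have : 0 <= n * (n * f i ^+ 2 - 2 * f i * a + b).
  have := sqr_ge0 (n * f i - a); have -> : (n * f i - a) ^+ 2 =
    n * (n * f i ^+ 2 - 2 * f i * a) + a ^+ 2 by ring.
  by rewrite mulrDr; lra.
by rewrite pmulr_rge0 //; lra.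
Qed.

Lemma exists_ge_average (R : realDomainType) (I : eqType) (s : seq I) (f : I -> R) (c : R) :
  s != [::] -> (size s)%:R * c <= \sum_(i <- s) f i -> exists2 i, i \in s & c <= f i.
Proof.
move=> sN0 le_sum; apply: contrapT => all_lt; move: le_sum.
rewrite -sumr_const_seq leNgt => /negP; apply.
rewrite big_seq [ltRHS]big_seq; apply: ltr_sum => [|i i_s].
  by case: s sN0 {all_lt} => //= i s _; rewrite mem_head.
by rewrite ltNge; apply/negP => ci; apply: all_lt; exists i.
Qed.

Section Blocks.
Local Open Scope nat_scope.
Variables (X T : eqType) (B : X -> seq T) (code : X -> T) (tie : pred X).

Lemma changes_flatten_le (F : seq X) c :
  {in F, forall x, if tie x then size (B x) <= 2 else subseq (B x) [:: code x]} ->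
  changes (c :: flatten (map B F)) <= changes (c :: map code F) + 4 * count tie F.
Proof.
elim: F c => [|x F IH] c BF; first by rewrite /= eqxx.
have {}IH d := IH d (fun y yF => BF y (mem_behead (s := x :: F) yF)).
have le_code := changes_cons2_le c (code x) (map code F).
have le_change (d d' : T) s : changes (d :: s) <= (changes (d' :: s)).+1.
  by rewrite (leq_trans (changes_cons_le _ _)) // ltnS changes_behead.
have := BF x (mem_head _ _); rewrite [flatten _]/= [map code _]/= [count _ _]/=.
case: (tie x); case: (B x) => [|d [|d' []]] //=.
- by move=> _; have := IH c; move: le_code; rewrite /=; lia.
- move=> _; have := IH d; have := le_change d (code x) (map code F).
  by have := leq_b1 (c != d); rewrite /=; lia.
- move=> _; have := IH d'; have := le_change d' (code x) (map code F).
  by have := leq_b1 (c != d); have := leq_b1 (d != d'); rewrite /=; lia.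
- by move=> _; have := IH c; move: le_code; rewrite /=; lia.
- by case: (d =P _) => // -> _; have := IH (code x); rewrite /=; lia.
- by case: (d =P _).
- by move=> e s; case: (d =P _).
Qed.

End Blocks.

Section Incidences.
Variable R : realType.
Implicit Types (m r eps C : R) (x y u v a b : 'rV[R]_3) (X U : seq 'rV[R]_3).

Record nonparallel X : Prop := Nonparallel {
  nonparallel_uniq : uniq X;
  nonparallel_neq0 : {in X, forall x, x != 0};
  nonparallel_sqarea : {in X &, forall x y, x != y -> sqarea x y != 0} }.

Lemma nonparallel_sub X X' : uniq X' -> {subset X' <= X} -> nonparallel X -> nonparallel X'.
Proof.
move=> uX' sX [_ X_neq0 X_area]; split=> // [x /sX|x y /sX xX /sX yX]; first exact: X_neq0.
exact: X_area.
Qed.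

Record config m X U : Prop := Config {
  config_gt0 : 0 < m;
  config_left : nonparallel X;
  config_right : nonparallel U;
  config_le : {in X & U, forall x u, sqarea x u <= m} }.

Lemma config_sub m X U X' U' : uniq X' -> uniq U' -> {subset X' <= X} -> {subset U' <= U} ->
  config m X U -> config m X' U'.
Proof.
move=> uX' uU' sX sU [m_gt0 XN UN le_m]; split=> //.
- exact: nonparallel_sub sX XN.
- exact: nonparallel_sub sU UN.
- by move=> x u /sX xX /sU uU; exact: le_m.
Qed.

Lemma config_sym m X U : config m X U -> config m U X.
Proof.
by case=> m_gt0 XN UN le_m; split=> // u x uU xX; rewrite sqareaC; exact: le_m.
Qed.

Definition degree m x U := count (fun u => sqarea x u == m) U.

Definition incidences m X U := (\sum_(x <- X) degree m x U)%N.

Lemma incidencesC m X U : incidences m X U = incidences m U X.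
Proof.
rewrite /incidences /degree exchange_count; apply: eq_bigr => u _.
by apply: eq_count => x; rewrite sqareaC.
Qed.

Lemma incidences_nilr m X : incidences m X [::] = 0%N.
Proof. by rewrite incidencesC /incidences big_nil. Qed.

Section OneCylinder.
Variables (m : R) (X U : seq 'rV[R]_3) (u0 : 'rV[R]_3).
Hypotheses (cfg : config m X U) (u0U : u0 \in U).
Implicit Type s : bool.

Definition incident_points := [seq x <- sweep X u0 | sqarea x u0 == m].

Definition touching s x := [seq a <- U | (a != u0) && touches X u0 s a x].

Let axis_neq0 u : u \in U -> u != u0 -> sqarea u u0 != 0.
Proof. by move=> uU uNu0; exact: nonparallel_sqarea (config_right cfg) _ _ _ _ _. Qed.

Lemma incident_pointsP x :
  x \in incident_points -> [/\ x \in sweep X u0, x \in X & sqarea x u0 = m].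
Proof.
by rewrite mem_filter => /andP[/eqP xm xs]; split=> //; move: xs; rewrite mem_sweep => /andP[].
Qed.

Lemma incident_within s x u : x \in incident_points -> u \in U -> u != u0 -> within X u0 s u x.
Proof.
move=> /incident_pointsP[xs xX xm] uU /(axis_neq0 uU) uu0.
have := within_sides xs uu0; rewrite xm (config_le cfg) // => /esym/andP[].
by case: s.
Qed.

Lemma uniq_incident_points : uniq incident_points.
Proof.
rewrite filter_uniq // (perm_uniq (perm_sweep _ _)) filter_uniq //.
exact: nonparallel_uniq (config_left cfg).
Qed.

Lemma count_tied_le4 a b : a \in U -> b \in U -> a != u0 -> b != u0 -> a != b ->
  (count (tied u0 a b) incident_points <= 4)%N.
Proof.
move=> aU bU aNu0 bNu0 aNb; rewrite -size_filter.
have sX : {subset [seq x <- incident_points | tied u0 a b x] <= X}.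
  by move=> x; rewrite mem_filter => /andP[_ /incident_pointsP[]].
apply: (@size_tied_le4 _ u0 a b).
- by rewrite sqareaC axis_neq0.
- by rewrite sqareaC axis_neq0.
- exact: nonparallel_sqarea (config_right cfg) _ _ _ _ _.
- by rewrite filter_uniq // uniq_incident_points.
- by move=> x y /sX xX /sX yX; exact: nonparallel_sqarea (config_left cfg) _ _ xX yX.
- exact: filter_all.
Qed.

Lemma touching_pair_code s a b x : a \in U -> b \in U -> a != u0 -> b != u0 ->
  x \in incident_points -> ~~ tied u0 a b x ->
  subseq [seq z <- touching s x | pred2 a b z] [:: if tighter X u0 s a b x then a else b].
Proof.
move=> aU bU aNu0 bNu0 xF xNtied; have [xs _ _] := incident_pointsP xF.
set code := if _ then a else b.
have z_code : {in [seq z <- touching s x | pred2 a b z], forall z, z = code}.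
  move=> z; rewrite !mem_filter => /andP[/orP[]/eqP -> /andP[/andP[_ x_touch] _]]; rewrite /code.
    by rewrite (touches_tighter x_touch) // incident_within.
  case: ifP => // ab; case/negP: xNtied.
  have a_touch := touches_tie x_touch (incident_within s xF aU aNu0) ab.
  by rewrite /tied !(@touches_sqarea _ X u0 s) ?axis_neq0.
apply: uniq_subseq1 z_code.
by rewrite !filter_uniq // (nonparallel_uniq (config_right cfg)).
Qed.

Lemma ds_word_touching s :
  ds_word (envelope_order + 17) (flatten (map (touching s) incident_points)).
Proof.
apply: ds_wordP => a b.
have mem_touching z : z \in flatten (map (touching s) incident_points) -> (z \in U) && (z != u0).
  by move=> /flatten_mapP[x _]; rewrite mem_filter => /andP[/andP[-> _] ->].
move=> /mem_touching/andP[aU aNu0] /mem_touching/andP[bU bNu0] aNb.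
pose code x := if tighter X u0 s a b x then a else b.
rewrite filter_flatten -map_comp; apply: leq_trans (changes_behead a _) _.
apply: leq_trans (@changes_flatten_le _ _ _ code (tied u0 a b) _ _ _) _.
  move=> x xF; case: ifPn => [_|xNtied] /=; last exact: touching_pair_code.
  apply: (@uniq_leq_size _ _ [:: a; b]).
    by rewrite !filter_uniq // (nonparallel_uniq (config_right cfg)).
  by move=> z; rewrite mem_filter !inE => /andP[].
have le_code : (changes (map code incident_points) <= envelope_order)%N.
  apply: (@leq_trans (changes (map (tighter X u0 s a b) incident_points))).
    by apply: changes_map_le => x y xy; rewrite /code xy.
  apply: leq_trans (changes_tighter _ s (axis_neq0 aU aNu0) (axis_neq0 bU bNu0)).
  exact/changes_subseq/map_subseq/filter_subseq.
have le_tied := leq_mul (leqnn 4) (count_tied_le4 aU bU aNu0 bNu0 aNb).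
apply: leq_trans (leq_add (changes_cons_le _ _) le_tied) _.
by rewrite addSn -addnS leq_add2r.
Qed.

Lemma degree_touching_le x : x \in incident_points ->
  (degree m x U <= 1 + size (touching false x) + size (touching true x))%N.
Proof.
move=> xF; have [xs _ xm] := incident_pointsP xF.
rewrite /degree /touching -!size_filter; set Ux := [seq u <- U | _].
rewrite -[1%N]/(size [:: u0]) -!size_cat; apply: uniq_leq_size.
  by rewrite filter_uniq // (nonparallel_uniq (config_right cfg)).
move=> u; rewrite mem_filter !mem_cat !mem_filter inE => /andP[/eqP xu uU].
have [//|uNu0] := eqVneq u u0; rewrite uU !andbT /=.
by rewrite -touches_sides ?axis_neq0 // xu xm.
Qed.

Lemma sum_touching_le s r C : 0 <= r -> ds_bound (envelope_order + 17) r C -> 0 <= C ->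
  (\sum_(x <- incident_points) size (touching s x))%:R <=
  (size incident_points)%:R + C * (size U)%:R `^ r.
Proof.
move=> r_ge0 dsC C_ge0.
have -> : (\sum_(x <- incident_points) size (touching s x) =
    size (flatten (map (touching s) incident_points)))%N.
  by rewrite size_flatten /shape -map_comp sumnE big_map.
have touching_uniq : all uniq (map (touching s) incident_points).
  by apply/allP => _ /mapP[x _ ->]; rewrite filter_uniq // (nonparallel_uniq (config_right cfg)).
have := size_flatten_changes touching_uniq; rewrite size_map -(ler_nat R) natrD.
move/le_trans; apply; rewrite lerD2l; apply: le_trans (dsC _ _ (ds_word_touching s)) _.
rewrite ler_wpM2l // ler_nat_powR //; apply: uniq_leq_size (undup_uniq _) _ => z.
by rewrite mem_undup => /flatten_mapP[x _]; rewrite mem_filter => /andP[].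
Qed.

Lemma perm_incident_points : perm_eq incident_points [seq x <- X | sqarea x u0 == m].
Proof.
have := perm_filter (fun x => sqarea x u0 == m) (perm_sweep X u0); rewrite -filter_predI.
move/perm_trans; apply; rewrite (eq_filter (a2 := fun x => sqarea x u0 == m)) // => x /=.
by case: eqP => //= ->; rewrite gt_eqF // (config_gt0 cfg).
Qed.

End OneCylinder.

Definition cylinder_bound r C := forall m X U u0, config m X U -> u0 \in U ->
  (\sum_(x <- X | sqarea x u0 == m) degree m x U)%:R <=
  C * ((degree m u0 X)%:R + (size U)%:R `^ r).

Lemma exists_cylinder_bound eps : 0 < eps -> exists2 C : R, 1 <= C & cylinder_bound (1 + eps) C.
Proof.
move=> eps_gt0; have [C C_ge0 dsC] := @davenport_schinzel R eps (envelope_order + 17) eps_gt0.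
exists (3 + 2 * C) => [|m X U u0 cfg u0U]; first by lra.
have perm_F := perm_incident_points u0 cfg.
rewrite -big_filter -(perm_big _ perm_F) /=.
have szF : size (incident_points m X u0) = degree m u0 X.
  by rewrite (perm_size perm_F) size_filter; apply: eq_count => x; rewrite sqareaC.
have : (\sum_(x <- incident_points m X u0) degree m x U <= degree m u0 X +
    \sum_(x <- incident_points m X u0) size (touching X U u0 false x) +
    \sum_(x <- incident_points m X u0) size (touching X U u0 true x))%N.
  rewrite -szF -sum1_size -!big_split /= big_seq [leqRHS]big_seq; apply: leq_sum => x.
  exact: degree_touching_le.
have r_ge0 : 0 <= 1 + eps by lra.
have le_touching s := sum_touching_le cfg u0U s r_ge0 dsC C_ge0.
rewrite -(ler_nat R) => /le_trans; apply; rewrite !natrD.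
have := le_touching false; have := le_touching true; rewrite szF.
have := powR_ge0 (size U)%:R (1 + eps); have : 0 <= (degree m u0 X)%:R :> R by [].
by move: (_ `^ _) => p; nra.
Qed.

Lemma solve_quadratic (C p q I : R) : 1 <= C -> 0 <= p -> 0 <= q -> 0 <= I ->
  I ^+ 2 <= C * q ^+ 2 * (I + p ^+ 2) -> I <= 2 * C * (q ^+ 2 + q * p).
Proof.
move=> C_ge1 p_ge0 q_ge0 I_ge0 I2; rewrite leNgt; apply/negP => ltI.
have Cqp_ge0 : 0 <= C * (q * p) by rewrite !mulr_ge0 //; lra.
have Cq2_ge0 : 0 <= C * q ^+ 2 by rewrite mulr_ge0 ?sqr_ge0 //; lra.
have le_linear : 2 * (C * q ^+ 2) * I <= I * I by rewrite ler_wpM2r //; lra.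
have le_constant : C * (q * p) ^+ 2 <= (C * (q * p)) ^+ 2.
  by rewrite [leRHS]exprMn ler_wpM2r ?sqr_ge0 // ler_eXnr.
have : 4 * (C * (q * p)) ^+ 2 <= I ^+ 2.
  have -> : 4 * (C * (q * p)) ^+ 2 = (2 * (C * (q * p))) ^+ 2 by ring.
  by rewrite lerXn2r ?nnegrE ?mulr_ge0 //; lra.
have : 0 < I ^+ 2 by rewrite exprn_gt0 //; lra.
move: I2 le_linear le_constant; rewrite -expr2.
have -> : C * q ^+ 2 * (I + p ^+ 2) = C * q ^+ 2 * I + C * (q * p) ^+ 2 by ring.
by lra.
Qed.

Definition sqrt_bound r C := forall m X U, config m X U ->
  (incidences m X U)%:R <= C * ((size U)%:R + Num.sqrt (size U)%:R * (size X)%:R `^ r).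

Lemma sum_sqr_degree m X U : (\sum_(u <- U) degree m u X ^ 2 =
  \sum_(x <- X) \sum_(u <- U | sqarea x u == m) degree m u X)%N.
Proof.
under [RHS]eq_bigr do rewrite big_mkcond /=.
rewrite exchange_big /=; apply: eq_bigr => u _.
rewrite -big_mkcond /= big_const_seq iter_addn_0 -mulnn; congr (_ * _)%N.
by apply: eq_count => x; rewrite sqareaC.
Qed.

Lemma exists_sqrt_bound eps : 0 < eps -> exists2 C : R, 1 <= C & sqrt_bound (1 + eps) C.
Proof.
move=> eps_gt0; have [|C C_ge1 cylC] := @exists_cylinder_bound (2 * eps); first by lra.
exists (2 * C) => [|m X U cfg]; first by lra.
set I := incidences m X U; set p := _ `^ _; set q := Num.sqrt _.
have qE : q ^+ 2 = (size U)%:R by rewrite sqr_sqrtr.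
rewrite -qE; apply: solve_quadratic => //; [exact: powR_ge0 | exact: sqrtr_ge0 | ].
rewrite qE /I incidencesC natr_sum; apply: le_trans (sqr_sum_le _ _) _.
rewrite -mulrA mulrCA ler_wpM2l //.
have -> : \sum_(u <- U) (degree m u X)%:R ^+ 2 =
    \sum_(x <- X) (\sum_(u <- U | sqarea u x == m) degree m u X)%:R :> R.
  under eq_bigr do rewrite -natrX.
  rewrite -natr_sum sum_sqr_degree natr_sum; apply: eq_bigr => x _.
  by under eq_bigl do rewrite sqareaC.
have -> : C * (\sum_(u <- U) (degree m u X)%:R + p ^+ 2) =
    \sum_(x <- X) C * ((degree m x U)%:R + (size X)%:R `^ (1 + 2 * eps)).
  rewrite -mulr_sumr big_split /= -!natr_sum -!/(incidences _ _ _) incidencesC.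
  rewrite sumr_const_seq /p -powR_mulrn ?powR_ge0 // -powRrM.
  rewrite -[X in X * _ `^ _]powRr1 // -powRD; last by apply/implyP => /eqP; lra.
  by congr (_ * (_ + _ `^ _)); ring.
rewrite big_seq [leRHS]big_seq; apply: ler_sum => x xX.
exact: cylC (config_sym cfg) xX.
Qed.

End Incidences.

(** * Envelopes, blocks and samples *)

Section Best.
Local Open Scope nat_scope.
Variables (T X : eqType) (ge : T -> T -> X -> bool).
Hypothesis ge_total : forall a b x, ge a b x || ge b a x.
Hypothesis ge_trans : forall a b c x, ge a b x -> ge b c x -> ge a c x.
Variables (S : seq T) (d : T).
Implicit Types (x : X) (a b : T).

Definition best x := nth d S (find (fun a => all (fun b => ge a b x) S) S).

Lemma has_best x : S != [::] -> has (fun a => all (fun b => ge a b x) S) S.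
Proof.
have ge_refl a : ge a a x by have := ge_total a a x; rewrite orbb.
elim: S => // c [|b s] IH _; first by rewrite /= ge_refl.
have /hasP[a a_s /allP a_max] := IH isT; apply/hasP.
have [ca|] := boolP (ge c a x).
  exists c; rewrite ?mem_head //; apply/allP => z; rewrite inE => /predU1P[->//|z_s].
  exact: ge_trans ca (a_max z z_s).
have := ge_total c a x; case: (ge c a x) => //= ac _.
exists a; first by rewrite inE a_s orbT.
by have /allP /= := a_max; rewrite ac.
Qed.

Lemma mem_best x : S != [::] -> best x \in S.
Proof. by move=> /(has_best x); rewrite has_find => ?; rewrite mem_nth. Qed.

Lemma best_ge x b : b \in S -> ge (best x) b x.
Proof.
move=> bS; have SN0 : S != [::] by case: (S) bS.
by have /(nth_find d)/allP/(_ b bS) := has_best x SN0.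
Qed.

Lemma before_best x a : uniq S -> a \in S -> index a S < index (best x) S ->
  ~~ ge a (best x) x.
Proof.
move=> uS aS lt_a; apply/negP => ge_a; have SN0 : S != [::] by case: (S) aS.
move: lt_a; rewrite index_uniq // -?has_find ?has_best //.
move/(before_find d)/negbT; rewrite nth_index // => /negP; apply.
by apply/allP => b bS; apply: ge_trans ge_a (best_ge _ bS).
Qed.

Lemma ds_word_best K (xs : seq X) : uniq S ->
  {in S &, forall a b, changes (map (ge a b) xs) <= K} -> ds_word K (map best xs).
Proof.
move=> uS geK; have [->|xsN0] := eqVneq xs [::]; first by [].
have [S0|SN0] := eqVneq S [::].
  apply: ds_wordP => a b /mapP[x _ ->] /mapP[y _ ->].
  by rewrite /best S0 !nth_nil eqxx.
have mapS : {subset map best xs <= S} by move=> _ /mapP[x _ ->]; exact: mem_best.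
apply: ds_wordP => a b /mapS aS /mapS bS.
wlog lt_ab : a b aS bS / index a S < index b S.
  move=> sym aNb; case: (ltngtP (index a S) (index b S)) => [|lt_ba|index_ab].
  - by move/sym; apply.
  - rewrite (eq_filter (a2 := pred2 b a)) ?sym 1?eq_sym //.
    by move=> z /=; rewrite orbC.
  - by case/eqP: aNb; rewrite -(nth_index d aS) index_ab nth_index.
move=> _; rewrite filter_map; set ys := seq.filter _ _.
have -> : map best ys = [seq if ge a b x then a else b | x <- ys].
  apply/eq_in_map => x; rewrite mem_filter /= => /andP[/orP[]/eqP best_x _].
    by rewrite -best_x best_ge.
  by have := @before_best x a uS aS; rewrite best_x => /(_ lt_ab)/negPf->.
apply: (@leq_trans (changes (map (ge a b) ys))).
  by apply: changes_map_le => x y ->.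
apply: leq_trans (geK a b aS bS).
exact/changes_subseq/map_subseq/filter_subseq.
Qed.

End Best.

Lemma constant_blocks (X T : eqType) (label : X -> T) (s : seq X) :
  exists bs : seq (seq X), [/\ flatten bs = s, [::] \notin bs,
    (size bs <= (changes (map label s)).+1)%N
    & {in bs, forall b, exists c, {in b, forall x, label x = c}}].
Proof.
elim: s => [|x [|y s] [bs [bsE bsN0 sz_bs bs_label]]]; first by exists [::].
  by exists [:: [:: x]]; split=> // b /[!inE] /eqP->; exists (label x) => z /[!inE] /eqP->.
case: bs bsE bsN0 sz_bs bs_label => [|[|y' b] bs] //= [] -> bsE bsN0 sz_bs bs_label.
have [xy|xNy] := eqVneq (label x) (label y).
  exists ([:: x, y & b] :: bs); split=> //=; first by rewrite bsE.
  move=> b' /[!inE] /predU1P[->|b'bs]; last by apply: bs_label; rewrite inE b'bs orbT.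
  have [|c yb_c] := bs_label (y :: b); first exact: mem_head.
  by exists c => z /[!inE] /predU1P[->|/yb_c//]; rewrite xy yb_c ?mem_head.
exists ([:: x] :: (y :: b) :: bs); split=> //=; first by rewrite bsE.
by move=> b' /[!inE] /predU1P[->|/bs_label//]; exists (label x) => z /[!inE] /eqP->.
Qed.

Section HittingSet.
Variables (R : realFieldType) (T J : eqType) (hits : J -> pred T) (U : seq T) (t n : R).
Hypotheses (t_gt0 : 0 < t) (le_tn : t <= n) (le_Un : (size U)%:R <= n).
Implicit Types (Js : seq J) (S : seq T).

Let n_gt0 : 0 < n. Proof. exact: lt_le_trans le_tn. Qed.

Let one_sub_ge0 : 0 <= 1 - t / n.
Proof. by rewrite subr_ge0 ler_pdivrMr // mul1r. Qed.

Lemma exists_popular Js : Js != [::] -> {in Js, forall j, t <= (count (hits j) U)%:R} ->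
  exists2 u, u \in U & (count (fun j => ~~ hits j u) Js)%:R <= (size Js)%:R * (1 - t / n).
Proof.
move=> JsN0 Js_large.
have [||u uU le_u] := @exists_ge_average _ _ U (fun u => (count (hits^~ u) Js)%:R)
    ((size Js)%:R * t / n).
- case: Js JsN0 Js_large => // j js _ /(_ j (mem_head _ _)); case: (U) => //=.
  by rewrite leNgt t_gt0.
- apply: (@le_trans _ _ ((size Js)%:R * t)).
    rewrite mulrCA ger_pMr ?mulr_gt0 ?ltr0n ?lt0n ?size_eq0 //.
    by rewrite ler_pdivrMr // mul1r.
  rewrite -sumr_const_seq -natr_sum -exchange_count natr_sum.
  by rewrite [leRHS]big_seq [leLHS]big_seq; exact: ler_sum.
exists u => //; rewrite mulrBr mulr1 mulrA.
have : (count (hits^~ u) Js)%:R + (count (fun j => ~~ hits j u) Js)%:R = (size Js)%:R :> R.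
  by rewrite -natrD -(count_predC (hits^~ u) Js).
by lra.
Qed.

Lemma hitting_set q Js : {in Js, forall j, t <= (count (hits j) U)%:R} ->
  exists S, [/\ {subset S <= U}, (size S <= q)%N
    & (count (fun j => ~~ has (hits j) S) Js)%:R <= (size Js)%:R * (1 - t / n) ^+ q].
Proof.
move=> Js_large; elim: q => [|q [S [SU szS le_S]]].
  by exists [::]; split=> //; rewrite mulr1 ler_nat count_size.
set missed := [seq j <- Js | ~~ has (hits j) S].
have le_missed : (size missed)%:R <= (size Js)%:R * (1 - t / n) ^+ q by rewrite size_filter.
have [missed0|missedN0] := eqVneq missed [::].
  exists S; split=> //; first exact: leqW.
  by rewrite -size_filter -/missed missed0 mulr_ge0 ?exprn_ge0 ?one_sub_ge0.
have [j|u uU le_u] := exists_popular missedN0.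
  by rewrite mem_filter => /andP[_]; exact: Js_large.
exists (u :: S); split=> //; first by move=> v /[!inE] /predU1P[->|/SU].
rewrite (eq_count (a2 := predI (fun j => ~~ hits j u) (fun j => ~~ has (hits j) S))); last first.
  by move=> j /=; rewrite negb_or.
rewrite -count_filter -/missed; apply: le_trans le_u _.
by rewrite exprSr mulrA ler_wpM2r ?one_sub_ge0.
Qed.

End HittingSet.

(** * The incidence bound *)

Lemma mem_flatten_slice (T : eqType) (bs : seq (seq T)) b : b \in bs ->
  exists2 i, b = take (size b) (drop i (flatten bs)) & (i + size b <= size (flatten bs))%N.
Proof.
case/splitPr => bs1 bs2; exists (size (flatten bs1)); rewrite flatten_cat /=.
  by rewrite drop_size_cat // take_size_cat.
by rewrite !size_cat leq_add2l leq_addr.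
Qed.

Lemma partition_big_seq (A : Type) (idx : A) (op : Monoid.com_law idx) (I J : eqType)
    (s : seq I) (t : seq J) (f : I -> J) (F : I -> A) :
  uniq t -> {in s, forall i, f i \in t} ->
  \big[op/idx]_(i <- s) F i = \big[op/idx]_(j <- t) \big[op/idx]_(i <- s | f i == j) F i.
Proof.
move=> t_uniq ft; rewrite (exchange_big_dep predT) //= big_seq [RHS]big_seq.
apply: eq_bigr => i i_s; rewrite -big_filter.
by rewrite (eq_filter (a2 := pred1 (f i))) ?filter_pred1_uniq ?ft ?big_seq1.
Qed.

Section Cells.
Variable R : realType.
Implicit Types (x u v : 'rV[R]_3) (X U S b : seq 'rV[R]_3) (s : bool).

(* [u] beats [u0] at some point of the block [b] between the bounds of [u1] and
   [u2], where [u1 = u0] or [u2 = u0] stands for no bound. *)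
Definition conflict X u0 u1 u2 b u :=
  has (fun x => [&& (u1 == u0) || within X u0 false u1 x,
                    (u2 == u0) || within X u0 true u2 x & sqarea x u0 < sqarea x u]) b.

Definition conflict_index : Type := ('rV[R]_3 * 'rV[R]_3 * 'rV[R]_3 * nat * nat)%type.

Definition conflict_list X (j : conflict_index) : pred 'rV[R]_3 :=
  let: (u0, u1, u2, i, l) := j in conflict X u0 u1 u2 (take l (drop i (sweep X u0))).

Definition conflict_indices X U : seq conflict_index :=
  let positions := iota 0 (size X).+1 in
  [seq (p, l) | p <- [seq (p, i) | p <- [seq (p, u2) | p <- [seq (u0, u1) |
    u0 <- U, u1 <- U], u2 <- U], i <- positions], l <- positions].

Lemma mem_conflict_indices X U u0 u1 u2 i l : u0 \in U -> u1 \in U -> u2 \in U ->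
  (i <= size X)%N -> (l <= size X)%N -> (u0, u1, u2, i, l) \in conflict_indices X U.
Proof. by move=> u0U u1U u2U le_i le_l; rewrite !allpairs_f ?mem_iota. Qed.

Lemma size_conflict_indices X U n : (0 < n)%N -> (size X <= n)%N -> (size U <= n)%N ->
  (size (conflict_indices X U) <= 4 * n ^ 5)%N.
Proof.
move=> n_gt0 le_Xn le_Un; rewrite !size_allpairs size_iota.
have le_2n : ((size X).+1 <= 2 * n)%N by rewrite mul2n -addnn -addn1 leq_add.
apply: (@leq_trans (n * n * n * (2 * n) * (2 * n))); first by rewrite !leq_mul.
by apply: eq_leq; rewrite !expnS expn0; ring.
Qed.

Definition good_sample (t : R) X U S := {in conflict_indices X U, forall j,
  ~~ has (conflict_list X j) S -> (count (conflict_list X j) U)%:R <= t}.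

Section Cell.
Variables (m t eps : R) (X U S : seq 'rV[R]_3) (u0 : 'rV[R]_3) (P : pred 'rV[R]_3) (n : nat).
Hypotheses (cfg : config m X U) (S_uniq : uniq S) (SU : {subset S <= U}) (u0S : u0 \in S).
Hypotheses (t_ge0 : 0 <= t) (sample : good_sample t X U S) (eps_gt0 : 0 < eps).
Hypotheses (le_Xn : (size X <= n)%N) (le_Un : (size U <= n)%N).
Hypothesis P_max : {in X, forall x, P x -> {in S, forall u, sqarea x u <= sqarea x u0}}.

Let others := [seq u <- S | u != u0].

Definition label s x := best (tighter X u0 s) others u0 x.

Definition interior x := P x && (sqarea x u0 != m).

Let r_ge0 : 0 <= 1 + eps. Proof. by rewrite addr_ge0 // ltW. Qed.

Let axis_neq0 u : u \in S -> u != u0 -> sqarea u u0 != 0.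
Proof.
by move=> /SU uU uNu0; exact: nonparallel_sqarea (config_right cfg) _ _ uU (SU u0S) _.
Qed.

Lemma uniq_sweep : uniq (sweep X u0).
Proof.
by rewrite (perm_uniq (perm_sweep _ _)) filter_uniq // (nonparallel_uniq (config_left cfg)).
Qed.

Lemma mem_label s x : label s x \in S.
Proof.
have [others0|othersN0] := eqVneq others [::]; first by rewrite /label /best others0.
have := mem_best (tighter_total X u0 s) (@tighter_trans _ X u0 s) u0 x othersN0.
by rewrite mem_filter => /andP[].
Qed.

Lemma label_tighter s x u : u \in S -> u != u0 ->
  label s x != u0 /\ tighter X u0 s (label s x) u x.
Proof.
move=> uS uNu0; have u_others : u \in others by rewrite mem_filter uNu0.
split; last exact: (best_ge (tighter_total X u0 s) (@tighter_trans _ X u0 s)).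
have othersN0 : others != [::] by case: others u_others.
have := mem_best (tighter_total X u0 s) (@tighter_trans _ X u0 s) u0 x othersN0.
by rewrite mem_filter => /andP[].
Qed.

Lemma ds_word_label s : ds_word envelope_order (map (label s) (sweep X u0)).
Proof.
apply: (ds_word_best (tighter_total X u0 s) (@tighter_trans _ X u0 s)).
  by rewrite filter_uniq.
move=> a b; rewrite !mem_filter => /andP[aNu0 aS] /andP[bNu0 bS].
by apply: changes_tighter; exact: axis_neq0.
Qed.

Definition block u1 u2 b :=
  {subset b <= sweep X u0} /\ {in b, forall x, label false x = u1 /\ label true x = u2}.

Lemma exists_blocks (C : R) : 0 <= C -> ds_bound envelope_order (1 + eps) C ->
  exists bs, [/\ flatten bs = sweep X u0, [::] \notin bs,
    (size bs)%:R <= 2 * (C * (size S)%:R `^ (1 + eps)) + 1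
    & {in bs, forall b, exists u1 u2, block u1 u2 b}].
Proof.
move=> C_ge0 dsC; pose lab x := (label false x, label true x).
have [bs [bsE bsN0 sz_bs bs_lab]] := constant_blocks lab (sweep X u0).
exists bs; split=> // [|b b_bs]; last first.
  have [[u1 u2] b_lab] := bs_lab b b_bs; exists u1, u2.
  split=> [x xb|x /b_lab[<- <-] //].
  by rewrite -bsE; apply/flattenP; exists b.
have le_label s : (changes (map (label s) (sweep X u0)))%:R <= C * (size S)%:R `^ (1 + eps).
  apply: le_trans (dsC _ _ (ds_word_label s)) _; rewrite ler_wpM2l // ler_nat_powR //.
  apply: uniq_leq_size (undup_uniq _) _ => u.
  by rewrite mem_undup => /mapP[x _ ->]; exact: mem_label.
have := @changes_map_le_add _ _ _ _ lab (label false) (label true) (sweep X u0).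
move=> /(_ (fun x y xy1 xy2 => congr2 pair xy1 xy2)); rewrite -(ler_nat R) natrD.
move: sz_bs; rewrite -(ler_nat R) -natr1.
by have := le_label false; have := le_label true; lra.
Qed.

Lemma block_unhit u1 u2 b : block u1 u2 b -> ~~ has (conflict X u0 u1 u2 b) S.
Proof.
case=> b_sweep b_lab; apply/hasPn => u uS; apply/hasPn => x xb.
have [uu0|uNu0] := eqVneq u u0; first by rewrite uu0 ltxx !andbF.
have [u1E u2E] := b_lab x xb.
have [u1N u1_tight] := label_tighter false x uS uNu0.
have [u2N u2_tight] := label_tighter true x uS uNu0.
rewrite u1E in u1N u1_tight; rewrite u2E in u2N u2_tight.
rewrite (negPf u1N) (negPf u2N) /= ltNge; apply/and3P => -[u1_within u2_within /negP[]].
rewrite (within_sides (b_sweep x xb)) ?axis_neq0 //.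
by rewrite (tighter_within u1_tight) ?(tighter_within u2_tight).
Qed.

Lemma label_within s x u : x \in sweep X u0 -> P x -> u \in S ->
  (u == u0) || within X u0 s u x.
Proof.
move=> xs Px uS; have [//|uNu0] := eqVneq u u0.
have xX : x \in X by move: xs; rewrite mem_sweep => /andP[].
by have := within_sides xs (axis_neq0 uS uNu0); rewrite P_max // => /esym/andP[]; case: s.
Qed.

Lemma degree_block u1 u2 b x : block u1 u2 b -> x \in b -> interior x ->
  degree m x U = degree m x [seq u <- U | conflict X u0 u1 u2 b u].
Proof.
move=> [b_sweep b_lab] xb /andP[Px xNm].
have xX : x \in X by have := b_sweep x xb; rewrite mem_sweep => /andP[].
rewrite /degree count_filter; apply: eq_in_count => u uU /=.
case: eqP => //= xu; apply/esym/hasP; exists x => //.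
have [<- <-] := b_lab x xb; rewrite !label_within ?mem_label ?b_sweep //=.
by rewrite xu lt_neqAle xNm (config_le cfg) // SU.
Qed.

Lemma block_bound (C : R) u1 u2 i l (b := take l (drop i (sweep X u0))) :
  0 <= C -> sqrt_bound (1 + eps) C -> block u1 u2 b -> b != [::] ->
  (i <= size X)%N -> (l <= size X)%N ->
  (\sum_(x <- b | interior x) degree m x U)%:R <=
  C * t + C * Num.sqrt t * n%:R `^ eps * (count interior b)%:R.
Proof.
move=> C_ge0 sqrtC b_block bN0 le_i le_l.
have [x0 x0b] : exists x0, x0 \in b by case: (b) bN0 => // x0 b' _; exists x0; exact: mem_head.
have [b_sweep b_lab] := b_block; have [u1E u2E] := b_lab x0 x0b.
have u1S : u1 \in S by rewrite -u1E mem_label.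
have u2S : u2 \in S by rewrite -u2E mem_label.
set Xb := [seq x <- b | interior x]; set Ub := [seq u <- U | conflict X u0 u1 u2 b u].
have -> : (\sum_(x <- b | interior x) degree m x U = incidences m Xb Ub)%N.
  rewrite -big_filter /incidences big_seq [RHS]big_seq; apply: eq_bigr => x.
  by rewrite mem_filter => /andP[x_int xb]; exact: degree_block b_block xb x_int.
have le_Ub : (size Ub)%:R <= t.
  rewrite size_filter; apply: (sample (mem_conflict_indices _ _ _ le_i le_l));
    rewrite ?SU //; exact: block_unhit.
have bX : {subset b <= X} by move=> x /b_sweep; rewrite mem_sweep => /andP[].
have XbX : {subset Xb <= X} by move=> x; rewrite mem_filter => /andP[_ /bX].
have Xb_uniq : uniq Xb by rewrite filter_uniq // take_uniq // drop_uniq // uniq_sweep.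
have cfg_b : config m Xb Ub.
  apply: config_sub cfg => //.
    by rewrite filter_uniq // (nonparallel_uniq (config_right cfg)).
  by move=> u; rewrite mem_filter => /andP[].
apply: le_trans (sqrtC _ _ _ cfg_b) _; rewrite mulrDr -!mulrA lerD ?ler_wpM2l //.
rewrite ler_pM ?sqrtr_ge0 ?powR_ge0 ?ler_wsqrtr // -size_filter -/Xb.
have [->|XbN0] := eqVneq Xb [::]; first by rewrite powR0 ?mulr0 // gt_eqF // ltr_pwDl // ltW.
rewrite addrC gt0_powRD ?ltr0n ?lt0n ?size_eq0 // powRr1 // ler_wpM2r //.
by rewrite ler_nat_powR ?(ltW eps_gt0) // (leq_trans _ le_Xn) // uniq_leq_size.
Qed.

Lemma interior_bound (C1 C2 : R) : 0 <= C1 -> 0 <= C2 -> sqrt_bound (1 + eps) C1 ->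
  ds_bound envelope_order (1 + eps) C2 ->
  (\sum_(x <- sweep X u0 | interior x) degree m x U)%:R <=
  C1 * t * (2 * (C2 * (size S)%:R `^ (1 + eps)) + 1) +
  C1 * Num.sqrt t * n%:R `^ eps * (count P X)%:R.
Proof.
move=> C1_ge0 C2_ge0 sqrtC1 dsC2.
have [bs [bsE bsN0 sz_bs bs_block]] := exists_blocks C2_ge0 dsC2.
have le_sweep : (size (sweep X u0) <= size X)%N.
  by rewrite (perm_size (perm_sweep _ _)) size_filter count_size.
pose K := C1 * Num.sqrt t * n%:R `^ eps.
have K_ge0 : 0 <= K by rewrite !mulr_ge0 ?sqrtr_ge0 ?powR_ge0.
rewrite -bsE big_flatten /= natr_sum.
apply: (@le_trans _ _ (\sum_(b <- bs) (C1 * t + K * (count interior b)%:R))).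
  rewrite big_seq [leRHS]big_seq; apply: ler_sum => b b_bs.
  have [u1 [u2 b_block]] := bs_block b b_bs.
  have [i bE le_b] := mem_flatten_slice b_bs; rewrite bsE in bE le_b.
  have bN0 : b != [::] by apply: contraNneq bsN0 => <-.
  rewrite bE in b_block bN0 *; apply: block_bound b_block bN0 _ _ => //.
    by rewrite (leq_trans _ le_sweep) // (leq_trans _ le_b) // leq_addr.
  by rewrite (leq_trans _ le_sweep) // (leq_trans _ le_b) // leq_addl.
rewrite big_split sumr_const_seq /= -mulr_sumr -natr_sum; apply: lerD.
  by rewrite mulrC ler_wpM2l ?mulr_ge0.
rewrite ler_wpM2l // ler_nat.
have -> : (\sum_(b <- bs) count interior b = count interior (sweep X u0))%N.
  by rewrite -bsE count_flatten sumnE big_map.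
rewrite (permP (perm_sweep _ _)) count_filter.
by apply: sub_count => x /= /andP[/andP[]].
Qed.

Lemma axis_bound : (\sum_(x <- X | sqarea x u0 == 0%R) degree m x U <= n)%N.
Proof.
rewrite -big_filter; set Z := [seq x <- X | _].
have : (size Z <= 1)%N.
  have ZP x : x \in Z -> x \in X /\ sqarea x u0 = 0 by rewrite mem_filter => /andP[/eqP].
  have: uniq Z by rewrite filter_uniq // (nonparallel_uniq (config_left cfg)).
  case: Z ZP => [|x [|y Z]] //= ZP /andP[+ _]; rewrite inE negb_or => /andP[xNy _].
  have [xX xu0] := ZP x (mem_head _ _).
  have [yX yu0] : y \in X /\ sqarea y u0 = 0 by apply: ZP; rewrite !inE eqxx orbT.
  have := nonparallel_sqarea (config_left cfg) xX yX xNy.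
  have u0_neq0 := nonparallel_neq0 (config_right cfg) (SU u0S).
  by rewrite (sqarea_eq0_trans u0_neq0 xu0 yu0) eqxx.
case: Z => [|x [|]] // _; rewrite ?big_nil // big_seq1.
exact: leq_trans (count_size _ _) le_Un.
Qed.

Lemma cell_bound (C0 C1 C2 : R) : 0 <= C0 -> 0 <= C1 -> 0 <= C2 ->
  cylinder_bound (1 + eps) C0 -> sqrt_bound (1 + eps) C1 -> ds_bound envelope_order (1 + eps) C2 ->
  (\sum_(x <- X | P x) degree m x U)%:R <=
  C0 * (n%:R + n%:R `^ (1 + eps)) + n%:R
  + C1 * t * (2 * (C2 * (size S)%:R `^ (1 + eps)) + 1)
  + C1 * Num.sqrt t * n%:R `^ eps * (count P X)%:R.
Proof.
move=> C0_ge0 C1_ge0 C2_ge0 cylC0 sqrtC1 dsC2.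
have sub_sum (Q Q' : pred 'rV[R]_3) : subpred Q Q' ->
    (\sum_(x <- X | Q x) degree m x U <= \sum_(x <- X | Q' x) degree m x U)%N.
  by move=> QQ'; rewrite big_mkcond [leqRHS]big_mkcond leq_sum // => x _;
     case: ifP => // /QQ' ->.
have -> : (\sum_(x <- X | P x) degree m x U =
    \sum_(x <- X | P x && (sqarea x u0 == m)) degree m x U +
    \sum_(x <- X | interior x && (sqarea x u0 == 0%R)) degree m x U +
    \sum_(x <- sweep X u0 | interior x) degree m x U)%N.
  rewrite (bigID (fun x => sqarea x u0 == m)) -addnA; congr (_ + _)%N.
  rewrite (bigID (fun x => sqarea x u0 == 0)); congr (_ + _)%N.
  rewrite (perm_big _ (perm_sweep _ _)) /= big_filter_cond.
  by apply: eq_bigl => x; rewrite andbC.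
rewrite !natrD -[leRHS]addrA; apply: lerD; last exact: interior_bound.
apply: lerD; last first.
  by rewrite ler_nat; apply: leq_trans axis_bound; apply: sub_sum => x /andP[].
apply: (@le_trans _ _ (\sum_(x <- X | sqarea x u0 == m) degree m x U)%:R).
  by rewrite ler_nat; apply: sub_sum => x /andP[].
apply: le_trans (cylC0 _ _ _ _ cfg (SU u0S)) _; rewrite ler_wpM2l // lerD //.
  by rewrite ler_nat (leq_trans (count_size _ _)).
by rewrite ler_nat_powR.
Qed.

End Cell.

Lemma sampled_incidence_bound (m t eps C0 C1 C2 : R) X U S n :
  config m X U -> uniq S -> {subset S <= U} -> S != [::] -> 0 <= t -> good_sample t X U S ->
  0 < eps -> (size X <= n)%N -> (size U <= n)%N -> 0 <= C0 -> 0 <= C1 -> 0 <= C2 ->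
  cylinder_bound (1 + eps) C0 -> sqrt_bound (1 + eps) C1 -> ds_bound envelope_order (1 + eps) C2 ->
  (incidences m X U)%:R <=
  (size S)%:R * (C0 * (n%:R + n%:R `^ (1 + eps)) + n%:R
                 + C1 * t * (2 * (C2 * (size S)%:R `^ (1 + eps)) + 1))
  + C1 * Num.sqrt t * n%:R `^ eps * n%:R.
Proof.
move=> cfg S_uniq SU SN0 t_ge0 S_good eps_gt0 le_Xn le_Un C0_ge0 C1_ge0 C2_ge0 cylC0 sqrtC1 dsC2.
have ge_total (a b x : 'rV[R]_3) : (sqarea x b <= sqarea x a) || (sqarea x a <= sqarea x b).
  exact: le_total.
have ge_trans (a b c x : 'rV[R]_3) : sqarea x b <= sqarea x a -> sqarea x c <= sqarea x b ->
    sqarea x c <= sqarea x a by move=> ab /le_trans; apply.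
pose f := best (fun a b x : 'rV[R]_3 => sqarea x b <= sqarea x a) S 0.
have fS : {in X, forall x, f x \in S} by move=> x _; exact: mem_best.
set A := (X in _ * X + _); set K := C1 * _ * _.
rewrite /incidences (partition_big_seq _ _ S_uniq fS) natr_sum.
apply: (@le_trans _ _ (\sum_(u <- S) (A + K * (count (fun x => f x == u) X)%:R))).
  rewrite big_seq [leRHS]big_seq; apply: ler_sum => u uS.
  apply: (cell_bound cfg S_uniq SU uS t_ge0 S_good) => //.
  by move=> x xX /eqP <- v vS; exact: (best_ge ge_total ge_trans).
rewrite big_split sumr_const_seq lerD2l /= -mulr_sumr ler_wpM2l //.
  by rewrite !mulr_ge0 ?sqrtr_ge0 ?powR_ge0.
rewrite -natr_sum ler_nat; apply: leq_trans le_Xn; apply: eq_leq.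
rewrite -[RHS]sum1_size [RHS](partition_big_seq _ _ S_uniq fS).
by apply: eq_bigr => u _; rewrite sum1_count.
Qed.

End Cells.

Section Sampling.
Variable R : realType.
Implicit Types (e : R) (n N q : nat) (X U S : seq 'rV[R]_3).

Lemma mul_expr_lt1 n N q : (0 < n)%N -> n%:R `^ (1 / 3) * ln (1 + N%:R) < q%:R :> R ->
  N%:R * (1 - n%:R `^ (2 / 3) / n%:R) ^+ q < 1 :> R.
Proof.
move=> n_gt0; set z : R := n%:R => lt_q; have z_ge1 : 1 <= z by rewrite ler1n.
have z_gt0 : 0 < z by lra.
set y := z `^ (2 / 3) / z; have y_gt0 : 0 < y by rewrite divr_gt0 ?powR_gt0.
have yz : y * z `^ (1 / 3) = 1.
  rewrite /y mulrAC -gt0_powRD // (_ : 2 / 3 + 1 / 3 = 1); last by field.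
  by rewrite powRr1 ?ltW // divff // gt_eqF.
have y_le1 : y <= 1 by rewrite ler_pdivrMr // mul1r ler1_powR //; lra.
apply: (@le_lt_trans _ _ (N%:R * expR (- ln (1 + N%:R)))).
  rewrite ler_wpM2l //; apply: (@le_trans _ _ (expR (- y) ^+ q)).
    by rewrite lerXn2r ?nnegrE ?expR_ge0 ?subr_ge0 //; have := expR_ge1Dx (- y); lra.
  rewrite -expRM_natl ler_expR.
  have := ler_wpM2l (ltW y_gt0) (ltW lt_q); rewrite mulrA yz; lra.
have N1_gt0 : 0 < 1 + N%:R :> R by rewrite ltr_pwDl.
by rewrite expRN lnK ?posrE // ltr_pdivrMr // mul1r ltrDr.
Qed.

Lemma exists_hitting_sample n X U : (0 < n)%N -> (size X <= n)%N -> (size U <= n)%N ->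
  exists S, [/\ {subset S <= U},
    (size S)%:R <= n%:R `^ (1 / 3) * ln (1 + (4 * n ^ 5)%:R) + 1 :> R
    & good_sample (n%:R `^ (2 / 3)) X U S].
Proof.
move=> n_gt0 le_Xn le_Un; set t := n%:R `^ (2 / 3).
have t_gt0 : 0 < t by rewrite powR_gt0 ?ltr0n.
have le_tn : t <= n%:R by rewrite ler1_powR ?ler1n //; lra.
pose large := [seq j <- conflict_indices X U | t <= (count (conflict_list X j) U)%:R].
have sz_large : (size large <= 4 * n ^ 5)%N.
  by rewrite (leq_trans _ (size_conflict_indices n_gt0 le_Xn le_Un)) // size_filter count_size.
set L := n%:R `^ (1 / 3) * ln (1 + (4 * n ^ 5)%:R).
have L_ge0 : 0 <= L by rewrite mulr_ge0 ?powR_ge0 // ln_ge0 // lerDl.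
have /andP[le_q lt_q] := truncn_itv L_ge0.
have le_Un' : (size U)%:R <= n%:R :> R by rewrite ler_nat.
have [|S [SU szS le_S]] := @hitting_set _ _ _ (conflict_list X) U t n%:R t_gt0 le_tn le_Un'
    (Num.truncn L).+1 large.
  by move=> j; rewrite mem_filter => /andP[].
have /eqP : count (fun j => ~~ has (conflict_list X j) S) large = 0%N.
  apply/eqP; rewrite -leqn0 -ltnS -(ltr_nat R); apply: le_lt_trans le_S _.
  apply: le_lt_trans (mul_expr_lt1 n_gt0 lt_q); rewrite ler_wpM2r ?ler_nat //.
  by rewrite exprn_ge0 // subr_ge0 ler_pdivrMr ?ltr0n // mul1r.
rewrite eqn0Ngt -has_count => /hasPn all_hit; exists S; split=> //.
  by apply: le_trans (_ : (Num.truncn L).+1%:R <= _); rewrite ?ler_nat // -natr1 lerD2r.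
move=> j jI S_unhit; rewrite leNgt; apply/negP => lt_t.
have j_large : j \in large by rewrite mem_filter (ltW lt_t).
by have := all_hit j j_large; rewrite S_unhit.
Qed.

Lemma exists_good_sample n X U : (0 < n)%N -> (size X <= n)%N -> (size U <= n)%N ->
  U != [::] -> exists S, [/\ uniq S, {subset S <= U}, S != [::],
    (size S)%:R <= n%:R `^ (1 / 3) * ln (1 + (4 * n ^ 5)%:R) + 2 :> R
    & good_sample (n%:R `^ (2 / 3)) X U S].
Proof.
move=> n_gt0 le_Xn le_Un; case: U le_Un => // v U le_Un _.
have [S [SU szS S_good]] := exists_hitting_sample n_gt0 le_Xn le_Un.
exists (undup (v :: S)); split.
- exact: undup_uniq.
- by move=> u; rewrite mem_undup inE => /predU1P[->|/SU//]; exact: mem_head.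
- by apply/eqP => /undup_nil.
- apply: (@le_trans _ _ (size (v :: S))%:R); first by rewrite ler_nat size_undup.
  by rewrite /= -natr1; lra.
move=> j jI; rewrite -all_predC => S_unhit; apply: S_good => //; rewrite -all_predC.
by move: S_unhit; rewrite (eq_all_r (mem_undup _)) => /andP[].
Qed.

Lemma exists_sample_size e : 0 < e -> exists2 D : R, 1 <= D & forall n, (0 < n)%N ->
  n%:R `^ (1 / 3) * ln (1 + (4 * n ^ 5)%:R) + 2 <= D * n%:R `^ (1 / 3 + e).
Proof.
move=> e_gt0; pose a := e / 5; have a_gt0 : 0 < a by rewrite divr_gt0.
pose D := 5 `^ a / a; have D_ge0 : 0 <= D by rewrite divr_ge0 ?powR_ge0 // ltW.
exists (D + 2) => [|n n_gt0]; first by lra.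
have n_ge1 : 1 <= n%:R :> R by rewrite ler1n.
have n5_ge1 : 1 <= n%:R ^+ 5 :> R by rewrite exprn_ege1.
have le_w : 1 <= n%:R `^ (1 / 3 + e) :> R by apply: powR_ge1 => //; lra.
rewrite mulrDl; apply: lerD; last by lra.
rewrite gt0_powRD ?ltr0n // mulrCA ler_wpM2l ?powR_ge0 //.
apply: le_trans (ln_le_powR _ a_gt0) _; first by rewrite ltr_pwDl.
rewrite /D mulrAC ler_wpM2r ?invr_ge0 ?(ltW a_gt0) //.
have -> : n%:R `^ e = (n%:R ^+ 5) `^ a :> R.
  by rewrite -powR_mulrn // -powRrM; congr (_ `^ _); rewrite /a; field.
rewrite -powRM ?exprn_ge0 // ge0_ler_powR ?nnegrE ?mulr_ge0 ?exprn_ge0 //.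
  exact: ltW.
by rewrite natrM natrX; lra.
Qed.

End Sampling.

Section Exponents.
Variable R : realType.
Implicit Types e z s D C : R.

Lemma sample_cylinder_le e z s D C : 0 < e -> 1 <= z -> 1 <= D -> 0 <= s -> 0 <= C ->
  s <= D * z `^ (1 / 3 + e) ->
  s * (C * (z + z `^ (1 + e)) + z) <= D * (2 * C + 1) * z `^ (4 / 3 + 4 * e).
Proof.
move=> e_gt0 z_ge1 D_ge1 s_ge0 C_ge0 le_s; have z_gt0 : 0 < z by lra.
have le_z : z <= z `^ (1 + e) by rewrite le1r_powR //; lra.
apply: (@le_trans _ _ ((D * z `^ (1 / 3 + e)) * ((2 * C + 1) * z `^ (1 + e)))).
  rewrite ler_pM ?addr_ge0 ?mulr_ge0 ?addr_ge0 ?powR_ge0 ?(ltW z_gt0) //.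
  by have := ler_wpM2l C_ge0 le_z; lra.
rewrite mulrACA ler_wpM2l -?gt0_powRD ?mulr_ge0 ?addr_ge0 ?mulr_ge0 //; try lra.
by apply: ler_powR => //; lra.
Qed.

Lemma powR_sample_le e z s D : 0 < e -> e <= 1 -> 1 <= z -> 1 <= D -> 0 <= s ->
  s <= D * z `^ (1 / 3 + e) -> s `^ (1 + e) <= D ^+ 2 * z `^ (1 / 3 + 3 * e).
Proof.
move=> e_gt0 e_le1 z_ge1 D_ge1 s_ge0 le_s; have D_ge0 : 0 <= D by lra.
apply: (@le_trans _ _ ((D * z `^ (1 / 3 + e)) `^ (1 + e))).
  by apply: ge0_ler_powR; rewrite ?nnegrE ?mulr_ge0 ?powR_ge0 //; lra.
rewrite powRM ?powR_ge0 // ler_pM ?powR_ge0 //.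
  by rewrite -powR_mulrn //; apply: ler_powR => //; lra.
by rewrite -powRrM; apply: ler_powR => //; nra.
Qed.

Lemma sample_blocks_le e z s D C1 C2 : 0 < e -> e <= 1 -> 1 <= z -> 1 <= D -> 0 <= s ->
  0 <= C1 -> 0 <= C2 -> s <= D * z `^ (1 / 3 + e) ->
  s * (C1 * z `^ (2 / 3) * (2 * (C2 * s `^ (1 + e)) + 1)) <=
  D * C1 * (2 * C2 * D ^+ 2 + 1) * z `^ (4 / 3 + 4 * e).
Proof.
move=> e_gt0 e_le1 z_ge1 D_ge1 s_ge0 C1_ge0 C2_ge0 le_s.
have z_gt0 : 0 < z by lra.
have w_ge1 : 1 <= z `^ (1 / 3 + 3 * e) by apply: powR_ge1 => //; lra.
have le_pow := powR_sample_le e_gt0 e_le1 z_ge1 D_ge1 s_ge0 le_s.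
apply: (@le_trans _ _ ((D * z `^ (1 / 3 + e)) *
    (C1 * z `^ (2 / 3) * ((2 * C2 * D ^+ 2 + 1) * z `^ (1 / 3 + 3 * e))))).
  apply: ler_pM => //; first by rewrite !mulr_ge0 ?addr_ge0 ?mulr_ge0 ?powR_ge0.
  rewrite ler_wpM2l ?mulr_ge0 ?powR_ge0 //.
  by have := ler_wpM2l C2_ge0 le_pow; lra.
have -> : 4 / 3 + 4 * e = (1 / 3 + e) + (2 / 3) + (1 / 3 + 3 * e) by field.
by rewrite !gt0_powRD // le_eqVlt; apply/orP; left; apply/eqP; ring.
Qed.

Lemma cells_le e z C : 0 < e -> 1 <= z -> 0 <= C ->
  C * Num.sqrt (z `^ (2 / 3)) * z `^ e * z <= C * z `^ (4 / 3 + 4 * e).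
Proof.
move=> e_gt0 z_ge1 C_ge0; have z_gt0 : 0 < z by lra.
rewrite -powR12_sqrt ?powR_ge0 // -powRrM -[X in _ * X <= _]powRr1 ?(ltW z_gt0) //.
rewrite -!mulrA -!gt0_powRD // ler_wpM2l //; apply: ler_powR => //; lra.
Qed.

End Exponents.

Section IncidenceBound.
Variable R : realType.
Implicit Types (eps e r C : R).

Definition incidence_bound r C := forall (m : R) X U n, config m X U ->
  (size X <= n)%N -> (size U <= n)%N -> (incidences m X U)%:R <= C * n%:R `^ r.

Lemma exists_incidence_bound_small e : 0 < e -> e <= 1 ->
  exists2 C : R, 0 <= C & incidence_bound (4 / 3 + 4 * e) C.
Proof.
move=> e_gt0 e_le1.
have [C0 C0_ge1 cylC0] := @exists_cylinder_bound R e e_gt0.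
have [C1 C1_ge1 sqrtC1] := @exists_sqrt_bound R e e_gt0.
have [C2 C2_ge0 dsC2] := @davenport_schinzel R e envelope_order e_gt0.
have [D D_ge1 szD] := exists_sample_size e_gt0.
have C0_ge0 : 0 <= C0 by lra.
have C1_ge0 : 0 <= C1 by lra.
have D2_ge0 : 0 <= D ^+ 2 by exact: sqr_ge0.
exists (D * (2 * C0 + 1) + D * C1 * (2 * C2 * D ^+ 2 + 1) + C1) => [|m X U n cfg le_Xn le_Un].
  by rewrite !addr_ge0 ?mulr_ge0 ?addr_ge0 ?mulr_ge0 //; lra.
have [n0|n_gt0] := posnP n.
  by move: le_Xn; rewrite n0 leqn0 size_eq0 => /eqP->; rewrite /incidences big_nil powR0 ?mulr0 //;
     lra.
have [U0|UN0] := eqVneq U [::].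
  rewrite U0 incidences_nilr mulr_ge0 ?powR_ge0 // !addr_ge0 ?mulr_ge0 ?addr_ge0 ?mulr_ge0 //; lra.
have [S [S_uniq SU SN0 szS S_good]] := exists_good_sample n_gt0 le_Xn le_Un UN0.
set z : R := n%:R; set s : R := (size S)%:R.
have := sampled_incidence_bound cfg S_uniq SU SN0 (powR_ge0 _ _) S_good e_gt0 le_Xn le_Un
  C0_ge0 C1_ge0 C2_ge0 cylC0 sqrtC1 dsC2; rewrite -/z -/s => /le_trans; apply.
rewrite mulrDr 2![(_ + _) * z `^ _]mulrDl; apply: lerD; first apply: lerD.
- by apply: sample_cylinder_le; rewrite ?ler1n // (le_trans szS) ?szD.
- by apply: sample_blocks_le; rewrite ?ler1n // (le_trans szS) ?szD.
- by apply: cells_le; rewrite ?ler1n.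
Qed.

Theorem exists_incidence_bound eps : 0 < eps ->
  exists2 C : R, 0 <= C & incidence_bound (4 / 3 + eps) C.
Proof.
move=> eps_gt0; pose e := Num.min 1 (eps / 4).
have e_gt0 : 0 < e by rewrite lt_min ltr01 divr_gt0.
have e_le1 : e <= 1 by rewrite ge_min lexx.
have e_le : 4 * e <= eps by rewrite mulrC -ler_pdivlMr // ge_min lexx orbT.
have [C C_ge0 boundC] := exists_incidence_bound_small e_gt0 e_le1.
exists C => // m X U n cfg le_Xn le_Un; apply: le_trans (boundC _ _ _ _ cfg le_Xn le_Un) _.
rewrite ler_wpM2l //; have [->|n_gt0] := posnP n; first by rewrite !powR0 ?gt_eqF //; lra.
by apply: ler_powR; rewrite ?ler1n // lerD2l.
Qed.

End IncidenceBound.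

(** * Triangles *)

Section Triangles.
Variable R : realType.
Implicit Types (a b c : 'rV[R]_3) (P T : {fset 'rV[R]_3}).

Lemma norm2E a : norm2 a = Num.sqrt (a *d a).
Proof. by congr Num.sqrt; apply: eq_bigr => i _; rewrite expr2. Qed.

Lemma areaE a b c : area a b c = Num.sqrt (sqarea (b - a) (c - a)) / 2.
Proof. by rewrite /area norm2E. Qed.

Lemma area_ge0 a b c : 0 <= area a b c.
Proof. by rewrite areaE divr_ge0 ?sqrtr_ge0. Qed.

Lemma sqarea_area a b c : sqarea (b - a) (c - a) = (2 * area a b c) ^+ 2.
Proof. by rewrite areaE mulrC divfK ?pnatr_eq0 // sqr_sqrtr ?sqarea_ge0. Qed.

Lemma collinearP a b c : collinear [fset a; b; c] <-> sqarea (b - a) (c - a) = 0.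
Proof.
split=> [[p [v pv]]|/eqP abc0].
  have [ta ->] : exists t, a = p + t *: v by apply: pv; rewrite !inE eqxx.
  have [tb ->] : exists t, b = p + t *: v by apply: pv; rewrite !inE eqxx orbT.
  have [tc ->] : exists t, c = p + t *: v by apply: pv; rewrite !inE eqxx orbT.
  have subE t : p + t *: v - (p + ta *: v) = (t - ta) *: v.
    by rewrite scalerBl opprD addrACA subrr add0r.
  by rewrite !subE sqareaZl sqareaC sqareaZl sqareaxx !mulr0.
have [ca|ca] := eqVneq (c - a) 0.
  exists a, (b - a) => x; rewrite !inE -orbA => /or3P[]/eqP->.
  - by exists 0; rewrite scale0r addr0.
  - by exists 1; rewrite scale1r addrC subrK.
  - by exists 0; rewrite scale0r addr0; apply/eqP; rewrite -subr_eq0 ca.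
have /(sqarea_eq0P _ ca)[t bE] := abc0.
exists a, (c - a) => x; rewrite !inE -orbA => /or3P[]/eqP->.
- by exists 0; rewrite scale0r addr0.
- by exists t; rewrite -bE addrC subrK.
- by exists 1; rewrite scale1r addrC subrK.
Qed.

Lemma max_area_trianglesP P T :
  reflect (T \in triangles P /\ forall T', T' \in triangles P -> tri_area T' <= tri_area T)
    (T \in max_area_triangles P).
Proof.
apply: (iffP idP) => [|[TP T_max]]; rewrite inE /=; first by move=> /andP[TP /asboolP].
by apply/andP; split=> //; exact/asboolP.
Qed.

Lemma triangles_sorted (f : 'rV[R]_3 -> R) P T : T \in triangles P -> exists a b c,
  [/\ T = [fset a; b; c], uniq [:: a; b; c], [/\ a \in P, b \in P & c \in P],
      f a <= f b /\ f a <= f c & sqarea (b - a) (c - a) != 0].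
Proof.
rewrite !inE /= => /and3P[TP /eqP T3 T_ncol].
have {}TP : {subset T <= P} by apply/fsubsetP; rewrite -fpowersetE.
pose s := sort (relpre f <=%R) (enum_fset T).
have mem_s x : (x \in s) = (x \in T) by rewrite mem_sort.
have s_uniq : uniq s by rewrite sort_uniq fset_uniq.
have : sorted (relpre f <=%R) s by apply: sort_sorted => x y; exact: le_total.
have : size s = 3 by rewrite size_sort.
case: s mem_s s_uniq => [|a [|b [|c [|]]]] //= mem_s s_uniq _ /and3P[ab bc _].
have TE : T = [fset a; b; c] by apply/fsetP => x; rewrite -mem_s !inE orbA.
exists a, b, c; split=> //.
- by split; apply: TP; rewrite -mem_s !inE eqxx ?orbT.
- by split=> //; exact: le_trans ab bc.
by apply: contra T_ncol => /eqP abc0; apply/asboolP; rewrite TE; exact/collinearP.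
Qed.

Lemma sqareaB_uniq a b c : sqarea (b - a) (c - a) != 0 -> uniq [:: a; b; c].
Proof.
move=> abc; have [ba ca] := sqarea_neq0 abc.
rewrite /= !inE negb_or -![a == _]eq_sym -!(subr_eq0 _ a) ba ca /= andbT.
by apply: contra_neq abc => ->; rewrite sqareaxx.
Qed.

Lemma mem_triangles P a b c : a \in P -> b \in P -> c \in P ->
  sqarea (b - a) (c - a) != 0 -> [fset a; b; c] \in triangles P.
Proof.
move=> aP bP cP abc; rewrite !inE /=; apply/and3P; split.
- suff : [fset a; b; c] \in fpowerset P by [].
  by rewrite fpowersetE; apply/fsubsetP => x; rewrite !inE => /orP[/orP[]|]/eqP->.
- have := sqareaB_uniq abc; rewrite /= !inE negb_or !andbT => /andP[/andP[ab ac] bc].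
  by rewrite fsetUC cardfsU1 cardfs2 !inE negb_or ![c == _]eq_sym ab ac bc.
by apply: contra abc => /asboolP/collinearP->.
Qed.

End Triangles.

Section UpperBound.
Variable R : realType.
Implicit Types (eps m : R) (k x y a b c : 'rV[R]_3) (V X U : seq 'rV[R]_3) (P : {fset 'rV[R]_3}).

Definition incident_vectors m V := [seq x <- V | has (fun u => sqarea x u == m) V].

Lemma incidences_incident_vectors m V :
  incidences m V V = incidences m (incident_vectors m V) (incident_vectors m V).
Proof.
have degreeE x : x \in V -> degree m x V = degree m x (incident_vectors m V).
  move=> xV; rewrite /degree count_filter; apply: eq_in_count => u uV /=.
  by case: eqP => //= xu; apply/esym/hasP; exists x; rewrite // sqareaC xu.
rewrite /incidences big_seq (eq_bigr _ degreeE) -big_seq.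
rewrite (bigID (fun x => has (fun u => sqarea x u == m) V)) /= -big_filter.
rewrite [X in (_ + X)%N]big1_seq ?addn0 // => x /andP[x_not xV].
by apply/eqP; rewrite -degreeE // -leqn0 leqNgt -has_count.
Qed.

(* Parallel vectors of an open half-space that both span the maximal area [m] are
   equal. *)
Lemma config_incident_vectors m k V : 0 < m -> uniq V -> {in V, forall x, 0 < k *d x} ->
  {in V &, forall x u, sqarea x u <= m} ->
  config m (incident_vectors m V) (incident_vectors m V).
Proof.
move=> m_gt0 V_uniq V_pos V_le; set W := incident_vectors m V.
have WP x : x \in W -> x \in V /\ exists2 u, u \in V & sqarea x u = m.
  by rewrite mem_filter => /andP[/hasP[u uV /eqP xu] xV]; split=> //; exists u.
have W_neq0 : {in W, forall x, x != 0}.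
  by move=> x /WP[/V_pos + _]; apply: contraTneq => ->; rewrite dotmul0r ltxx.
have W_nonparallel : nonparallel W.
  split=> [||x y xW yW]; rewrite ?filter_uniq //.
  have [[xV [u uV xu]] [yV [v vV yv]]] := (WP x xW, WP y yW).
  apply: contra_neqN => /(sqarea_eq0P _ (W_neq0 y yW))[c xE].
  have c_ge0 : 0 <= c by have := V_pos x xV; rewrite xE dotmulZr pmulr_lgt0 ?V_pos // => /ltW.
  have xw w : sqarea x w = c ^+ 2 * sqarea y w by rewrite xE sqareaZl.
  have c2_ge1 : m <= c ^+ 2 * m by rewrite -{1}xu xw ler_wpM2l ?sqr_ge0 ?V_le.
  have c2_le1 : c ^+ 2 * m <= m by rewrite -{1}yv -xw V_le.
  have /eqP : c ^+ 2 = 1.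
    by apply: (mulIf (lt0r_neq0 m_gt0)); rewrite mul1r; apply/le_anti; rewrite c2_le1.
  by rewrite pexpr_eq1 // => /eqP c1; rewrite xE c1 scale1r.
by split=> // x u /WP[xV _] /WP[uV _]; exact: V_le.
Qed.

Lemma exists_half_space_bound eps : 0 < eps -> exists2 C : R, 0 <= C &
  forall m k V, 0 < m -> uniq V -> {in V, forall x, 0 < k *d x} ->
    {in V &, forall x u, sqarea x u <= m} ->
    (incidences m V V)%:R <= C * (size V)%:R `^ (4 / 3 + eps).
Proof.
move=> eps_gt0; have [C C_ge0 boundC] := exists_incidence_bound eps_gt0.
exists C => // m k V m_gt0 V_uniq V_pos V_le; rewrite incidences_incident_vectors.
have cfg := config_incident_vectors m_gt0 V_uniq V_pos V_le.
by apply: boundC => //; rewrite size_filter count_size.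
Qed.

Definition incident_pairs m X U :=
  [seq q <- [seq (x, u) | x <- X, u <- U] | sqarea q.1 q.2 == m].

Lemma size_incident_pairs m X U : size (incident_pairs m X U) = incidences m X U.
Proof.
rewrite size_filter /incidences; elim: X => [|x X IH]; first by rewrite big_nil.
by rewrite big_cons allpairs_cons count_cat -IH count_map.
Qed.

(* Every triangle is counted at its lowest vertex with respect to [k]. *)
Definition upward_edges k P a := [seq b - a | b <- enum_fset P & k *d a < k *d b].

Lemma size_upward_edges k P a : (size (upward_edges k P a) <= #|` P|)%N.
Proof. by rewrite size_map size_filter count_size. Qed.

Lemma uniq_upward_edges k P a : uniq (upward_edges k P a).
Proof. by rewrite map_inj_uniq ?filter_uniq ?fset_uniq // => b c; exact: addIr. Qed.

Lemma upward_edgesP k P a x :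
  reflect (exists b, [/\ b \in P, x = b - a & k *d a < k *d b]) (x \in upward_edges k P a).
Proof.
apply: (iffP mapP) => [[b]|[b [bP -> ab]]].
  by rewrite mem_filter => /andP[ab bP] ->; exists b.
by exists b; rewrite // mem_filter ab.
Qed.

Lemma max_area_triangles_sqarea P T0 a b c : T0 \in max_area_triangles P ->
  a \in P -> b \in P -> c \in P -> sqarea (b - a) (c - a) <= (2 * tri_area T0) ^+ 2.
Proof.
case/max_area_trianglesP=> _ T0_max aP bP cP.
have [->|abc] := eqVneq (sqarea (b - a) (c - a)) 0; first exact: sqr_ge0.
have := T0_max _ (mem_triangles aP bP cP abc).
rewrite tri_areaE ?sqareaB_uniq // sqarea_area => le_area.
have abc_ge0 := area_ge0 a b c.
by apply: lerXn2r; rewrite ?nnegrE; lra.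
Qed.

Lemma card_max_area_triangles_le P T0 k : T0 \in max_area_triangles P ->
  {in P &, forall a b, a != b -> k *d a != k *d b} ->
  (#|` max_area_triangles P| <=
   \sum_(a <- enum_fset P) incidences ((2 * tri_area T0) ^+ 2)
     (upward_edges k P a) (upward_edges k P a))%N.
Proof.
set m := (2 * tri_area T0) ^+ 2; move=> T0M k_inj.
pose pairs a := incident_pairs m (upward_edges k P a) (upward_edges k P a).
under eq_bigr do rewrite -size_incident_pairs.
pose spanned := [seq [fset a; a + q.1; a + q.2] | a <- enum_fset P, q <- pairs a].
apply: (@leq_trans (size spanned)); last by rewrite size_allpairs_dep sumnE big_map.
apply: uniq_leq_size; first exact: fset_uniq.
move=> T /max_area_trianglesP[TP T_max]; have /max_area_trianglesP[T0P T0_max] := T0M.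
have [a [b [c [TE abc [aP bP cP] [ab ac] _]]]] := triangles_sorted (dotmul k) TP.
apply/allpairsPdep; exists a, (b - a, c - a); split=> //=; last first.
  by rewrite !(addrC a) !subrK.
have [aNb aNc] : a != b /\ a != c.
  by move: abc; rewrite /= !inE negb_or => /andP[/andP[]].
rewrite mem_filter /= sqarea_area -(tri_areaE abc) -TE.
have -> : tri_area T = tri_area T0 by apply/le_anti; rewrite T_max ?T0_max.
rewrite eqxx /=; apply: allpairs_f; apply/upward_edgesP; [exists b | exists c];
  by rewrite lt_neqAle k_inj.
Qed.

Theorem card_max_area_triangles_bound eps : 0 < eps -> exists C : R, forall n P,
  #|` P| = n -> #|` max_area_triangles P|%:R <= C * n%:R `^ (7 / 3 + eps).
Proof.
move=> eps_gt0; have [C C_ge0 boundC] := exists_half_space_bound eps_gt0.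
exists C => n P szP; have [->|[T0 T0M]] := fset_0Vmem (max_area_triangles P).
  by rewrite cardfs0 mulr_ge0 ?powR_ge0.
have [k k_generic] := generic_functional [seq a - b | a <- enum_fset P, b <- enum_fset P].
have k_inj : {in P &, forall a b, a != b -> k *d a != k *d b}.
  move=> a b aP bP aNb; rewrite -subr_eq0 -dotmulBr k_generic ?subr_eq0 //.
  exact: allpairs_f.
set m := (2 * tri_area T0) ^+ 2.
have m_gt0 : 0 < m.
  have /max_area_trianglesP[T0P _] := T0M.
  have [a [b [c [T0E abc _ _ abc_neq0]]]] := triangles_sorted (fun=> 0) T0P.
  by rewrite /m T0E tri_areaE // -sqarea_area sqarea_gt0.
have le_vertex a : a \in P -> (incidences m (upward_edges k P a) (upward_edges k P a))%:R <=
    C * n%:R `^ (4 / 3 + eps).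
  move=> aP; apply: (@le_trans _ _ (C * (size (upward_edges k P a))%:R `^ (4 / 3 + eps))).
    apply: (boundC _ k) => //; first exact: uniq_upward_edges.
      by move=> _ /upward_edgesP[b [_ -> ab]]; rewrite dotmulBr subr_gt0.
    move=> _ _ /upward_edgesP[b [bP -> _]] /upward_edgesP[c [cP -> _]].
    exact: max_area_triangles_sqarea T0M aP bP cP.
  by rewrite ler_wpM2l // ler_nat_powR -?szP ?size_upward_edges //; lra.
apply: (@le_trans _ _ (\sum_(a <- enum_fset P) C * n%:R `^ (4 / 3 + eps))).
  apply: (@le_trans _ _ (\sum_(a <- enum_fset P)
      (incidences m (upward_edges k P a) (upward_edges k P a))%:R)).
    by rewrite -natr_sum ler_nat card_max_area_triangles_le.
  by rewrite big_seq [leRHS]big_seq; apply: ler_sum.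
rewrite sumr_const_seq [size _]szP mulrCA ler_wpM2l //.
rewrite -[X in X * _ <= _]powRr1 // -powRD; last by rewrite gt_eqF //; lra.
by rewrite (_ : 1 + (4 / 3 + eps) = 7 / 3 + eps) //; field.
Qed.

End UpperBound.

(** * A set with many triangles of maximum area *)

Section UnitVectors.
Variable R : realType.
Implicit Types (u v w p q r a b c : 'rV[R]_3) (i : 'I_3).

Lemma sqr_coord_le i v : v 0 i ^+ 2 <= v *d v.
Proof.
by rewrite /dotmul (bigD1 i) //= -expr2 lerDl sumr_ge0 // => j _; exact: sqr_ge0.
Qed.

Lemma sqarea_le u v : sqarea u v <= (u *d u) * (v *d v).
Proof. by rewrite sqareaE lerBlDr lerDl sqr_ge0. Qed.

Lemma unit_parallelogram p q : p *d p = 1 -> q *d q = 1 ->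
  (q - p) *d (q - p) = 4 - (q + p) *d (q + p).
Proof.
by move=> p1 q1; rewrite !dotmulBl !dotmulBr !dotmulDl !dotmulDr p1 q1 (dotmulC p q); ring.
Qed.

Definition near i v := (v *d v == 1) && (97 / 100 <= v 0 i).

Lemma near_unit i v : near i v -> v *d v = 1.
Proof. by case/andP=> /eqP. Qed.

Lemma near_neq0 i v : near i v -> v != 0.
Proof. by move=> /near_unit v1; rewrite -dotmul_gt0 v1 ltr01. Qed.

Lemma near01_disjoint v : near 0 v -> ~~ near 1 v.
Proof.
move=> /andP[/eqP v1 v0_ge]; apply/negP => /andP[_ v1_ge].
have := sqr_ge0 (v 0 2); move: v1; rewrite dotmul3E -!expr2; nra.
Qed.

Lemma near_close i p q : near i p -> near i q -> (q - p) *d (q - p) <= 1 / 4.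
Proof.
move=> /andP[/eqP p1 pi] /andP[/eqP q1 qi]; rewrite unit_parallelogram //.
by have := sqr_coord_le i (q + p); rewrite mxE; nra.
Qed.

Lemma area_le_half a b c : sqarea (b - a) (c - a) <= 1 -> area a b c <= 1 / 2.
Proof.
move=> abc_le1; rewrite areaE ler_wpM2r ?invr_ge0 // -[leRHS]sqrtr1.
exact: ler_wsqrtr.
Qed.

Lemma area_near_close i p q r : near i p -> near i q -> r *d r = 1 -> area p q r <= 1 / 2.
Proof.
move=> pi qi r1; apply: area_le_half; apply: le_trans (sqarea_le _ _) _.
have rp_le : (r - p) *d (r - p) <= 4.
  by rewrite unit_parallelogram ?(near_unit pi) // lerBlDr lerDl dotmul_ge0.
have -> : 1 = 1 / 4 * 4 :> R by field.
by rewrite ler_pM ?dotmul_ge0 ?(near_close pi).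
Qed.

Definition cluster v := [|| v == 0, near 0 v | near 1 v].

Lemma area_cluster0 q r : cluster q -> cluster r -> area 0 q r <= 1 / 2.
Proof.
have cluster_le1 v : cluster v -> v *d v <= 1.
  by case/or3P=> [/eqP->|/near_unit->|/near_unit->] //; rewrite dotmul0r.
move=> /cluster_le1 q1 /cluster_le1 r1; apply: area_le_half; rewrite !subr0.
by apply: le_trans (sqarea_le _ _) _; rewrite mulr_ile1 ?dotmul_ge0.
Qed.

Lemma area_cluster p q r : cluster p -> cluster q -> cluster r -> area p q r <= 1 / 2.
Proof.
move=> cp cq cr; have [p0|pN0] := eqVneq p 0; first by rewrite p0 area_cluster0.
have [q0|qN0] := eqVneq q 0; first by rewrite q0 area_swap12 area_cluster0.
have [r0|rN0] := eqVneq r 0; first by rewrite r0 area_swap23 area_swap12 area_cluster0.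
move: cp cq cr; rewrite /cluster (negPf pN0) (negPf qN0) (negPf rN0) /=.
case/orP=> np; case/orP=> nq; case/orP=> nr;
  first [ by apply: area_near_close np nq (near_unit nr)
        | by rewrite area_swap23; apply: area_near_close np nr (near_unit nq)
        | by rewrite area_swap12 area_swap23; apply: area_near_close nq nr (near_unit np)].
Qed.

Definition normalize v := (Num.sqrt (v *d v))^-1 *: v.

Lemma normalize_unit v : v != 0 -> normalize v *d normalize v = 1.
Proof.
rewrite -dotmul_gt0 => v_gt0; rewrite dotmulZl dotmulZr -{3}(sqr_sqrtr (ltW v_gt0)) expr2.
by field; rewrite gt_eqF // sqrtr_gt0.
Qed.

Lemma near_normalize i v : v 0 i = 1 -> v *d v <= 101 / 100 -> near i (normalize v).
Proof.
move=> vi v_le; have v_ge1 : 1 <= v *d v by rewrite -(expr1n _ 2) -vi sqr_coord_le.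
rewrite /near normalize_unit -?dotmul_gt0 ?(lt_le_trans ltr01) //= mxE vi mulr1 eqxx /=.
have sqrt_ge1 : 1 <= Num.sqrt (v *d v) by rewrite -[leLHS]sqrtr1 ler_wsqrtr.
have sqrtE := sqr_sqrtr (le_trans ler01 v_ge1).
rewrite -[leLHS]invrK lef_pV2 ?posrE; try lra.
by apply: (@le_trans _ _ (101 / 100)); [nra | rewrite invf_div; lra].
Qed.

Lemma normalize_inj i v w : v 0 i = 1 -> w 0 i = 1 -> normalize v = normalize w -> v = w.
Proof.
move=> vi wi vw; have v_neq0 : v *d v != 0.
  by rewrite dotmul_eq0; apply: contraPneq vi => ->; rewrite mxE => /esym/eqP; rewrite oner_eq0.
have := congr1 (fun z : 'rV_3 => z 0 i) vw; rewrite !mxE vi wi !mulr1 => scaleE.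
apply: (scalerI (_ : (Num.sqrt (v *d v))^-1 != 0)); last by rewrite {2}scaleE.
by rewrite invr_eq0 gt_eqF // sqrtr_gt0 lt_def v_neq0 dotmul_ge0.
Qed.

Definition row3 (x y z : R) : 'rV[R]_3 := \row_i [:: x; y; z]`_i.

Lemma row3E x y z : (row3 x y z 0 0 = x) * (row3 x y z 0 1 = y) * (row3 x y z 0 2 = z).
Proof. by rewrite !mxE. Qed.

Definition quarter_turn v := row3 (- v 0 1) (v 0 0) (- v 0 2).

Lemma dotmul_quarter_turn u v : quarter_turn u *d quarter_turn v = u *d v.
Proof. by rewrite !dotmul3E !row3E; ring. Qed.

Lemma near_quarter_turn v : near 1 (quarter_turn v) = near 0 v.
Proof. by rewrite /near dotmul_quarter_turn row3E. Qed.

Lemma quarter_turn_inj : injective quarter_turn.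
Proof.
move=> u v uv; have coordE i := congr1 (fun w : 'rV_3 => w 0 i) uv.
have := (coordE 0, coordE 1, coordE 2); rewrite !row3E => -[[/oppr_inj u1 u0] /oppr_inj u2].
exact: row3P.
Qed.

End UnitVectors.

(* [grid_point i] and [grid_line j] play the point [(i %% k, i %/ k)] and the line
   [y = j %/ k + (j %% k) x] of a grid: incidence is orthogonality. *)
Section GridConstruction.
Variables (R : realType) (k n : nat).
Hypotheses (k_gt0 : (0 < k)%N) (le_kn : (3 * k ^ 3 <= n)%N).
Implicit Types (i j : nat) (z : nat * nat) (v : 'rV[R]_3).

Definition spacing : R := (100 * n%:R)^-1.

Definition lift_grid i : 'rV[R]_3 :=
  row3 1 (spacing ^+ 2 * (i %/ k)%:R) (spacing * (i %% k)%:R).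

Definition grid_point i := normalize (lift_grid i).

Definition grid_line i := quarter_turn (grid_point i).

Let n_gt0 : (0 < n)%N.
Proof. by apply: leq_trans le_kn; rewrite muln_gt0 expn_gt0 k_gt0. Qed.

Lemma spacing_gt0 : 0 < spacing.
Proof. by rewrite invr_gt0 mulr_gt0 // ltr0n n_gt0. Qed.

Lemma lift_grid_le i : (i <= n)%N -> lift_grid i *d lift_grid i <= 101 / 100.
Proof.
move=> le_in; have small j : (j <= n)%N -> 0 <= spacing * j%:R <= 1 / 100.
  move=> le_jn; rewrite mulr_ge0 ?(ltW spacing_gt0) //=.
  rewrite /spacing mulrC ler_pdivrMr ?mulr_gt0 ?ltr0n ?n_gt0 //.
  by rewrite mulrA mul1r mulVf ?mul1r ?ler_nat // pnatr_eq0.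
have /andP[s_ge0 s_le] := small _ (leq_trans (leq_div i k) le_in).
have /andP[_ d_le] := small 1%N n_gt0; rewrite mulr1 in d_le.
have ds_small : 0 <= spacing ^+ 2 * (i %/ k)%:R <= 1 / 100.
  rewrite expr2 -mulrA mulr_ge0 ?(ltW spacing_gt0) //=; apply: le_trans s_le.
  by rewrite ler_piMl // (le_trans d_le) //; lra.
have sqr_le (y : R) : 0 <= y <= 1 / 100 -> y ^+ 2 <= 1 / 200 by case/andP=> y_ge0 y_le; nra.
have := sqr_le _ ds_small; have := sqr_le _ (small _ (leq_trans (leq_mod i k) le_in)).
by rewrite dotmul3E !row3E -!expr2 expr1n; lra.
Qed.

Lemma near_grid_point i : (i <= n)%N -> near 0 (grid_point i).
Proof. by move=> le_in; apply: near_normalize; [rewrite row3E | exact: lift_grid_le]. Qed.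

Lemma near_grid_line i : (i <= n)%N -> near 1 (grid_line i).
Proof. by rewrite near_quarter_turn; exact: near_grid_point. Qed.

Lemma grid_point_inj : injective grid_point.
Proof.
move=> i j /(@normalize_inj _ 0)/= => /(_ _ _)/= ij.
have {}ij : lift_grid i = lift_grid j by apply: ij; rewrite row3E.
have coordE a := congr1 (fun v : 'rV_3 => v 0 a) ij.
have spacing_neq0 : spacing != 0 by rewrite gt_eqF // spacing_gt0.
have := (coordE 1, coordE 2); rewrite !row3E => -[].
move=> /(mulfI (expf_neq0 2 spacing_neq0))/eqP + /(mulfI spacing_neq0)/eqP.
by rewrite !eqr_nat => /eqP divE /eqP modE; rewrite (divn_eq i k) divE modE -divn_eq.
Qed.

Lemma grid_line_inj : injective grid_line.
Proof. by move=> i j /quarter_turn_inj/grid_point_inj. Qed.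

Lemma grid_orthogonal i j :
  (i %/ k = j %/ k + i %% k * (j %% k))%N -> grid_point i *d grid_line j = 0.
Proof.
move=> iE; have turnZ c v : quarter_turn (c *: v) = c *: quarter_turn v.
  by apply: row3P; rewrite ?[(_ *: quarter_turn _) _ _]mxE !row3E !mxE ?mulrN.
rewrite /grid_line /grid_point /normalize turnZ dotmulZl dotmulZr.
rewrite (_ : _ *d quarter_turn _ = 0) ?mulr0 //.
by rewrite dotmul3E !row3E iE natrD natrM; ring.
Qed.

(* Surplus grid points pad the configuration to exactly [n] points. *)
Definition grid_vectors : seq 'rV[R]_3 :=
  0 :: [seq grid_point i | i <- iota 0 (n - (k ^ 3).+1)] ++
       [seq grid_line i | i <- iota 0 (k ^ 3)].

Let k3_lt_n : (k ^ 3 < n)%N.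
Proof. by have : (0 < k ^ 3)%N by [rewrite expn_gt0 k_gt0]; move: le_kn; lia. Qed.

Lemma grid_vectorsP v : v \in grid_vectors ->
  [\/ v = 0, exists2 i, (i <= n)%N & v = grid_point i
   | exists2 i, (i <= n)%N & v = grid_line i].
Proof.
rewrite inE mem_cat => /or3P[/eqP->|/mapP[i]|/mapP[i]]; rewrite ?mem_iota /=.
- by constructor 1.
- by move=> lt_i ->; constructor 2; exists i => //; move: lt_i; lia.
- by move=> lt_i ->; constructor 3; exists i => //; move: lt_i k3_lt_n; lia.
Qed.

Lemma cluster_grid_vectors v : v \in grid_vectors -> cluster v.
Proof.
by case/grid_vectorsP=> [->|[i le_in ->]|[i le_in ->]]; rewrite /cluster ?eqxx //
   ?(near_grid_point le_in) ?(near_grid_line le_in) ?orbT.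
Qed.

Lemma uniq_grid_vectors : uniq grid_vectors.
Proof.
have le_point i : i \in iota 0 (n - (k ^ 3).+1) -> (i <= n)%N by rewrite mem_iota; lia.
have le_line i : i \in iota 0 (k ^ 3) -> (i <= n)%N by rewrite mem_iota; move: k3_lt_n; lia.
rewrite /= mem_cat negb_or cat_uniq !map_inj_uniq ?iota_uniq ?andbT /=;
  [|exact: grid_line_inj|exact: grid_point_inj].
rewrite -andbA; apply/and3P; split.
- by apply/mapP => -[i /le_point/near_grid_point/near_neq0 + /esym/eqP]; move=> /negPf->.
- by apply/mapP => -[i /le_line/near_grid_line/near_neq0 + /esym/eqP]; move=> /negPf->.
apply/hasPn => _ /mapP[i /le_line/near_grid_line near1 ->].
apply/mapP => -[j /le_point/near_grid_point near0 ij].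
by have := near01_disjoint near0; rewrite -ij near1.
Qed.

Definition grid_set : {fset 'rV[R]_3} := [fset v in grid_vectors].

Lemma mem_grid_set v : (v \in grid_set) = (v \in grid_vectors).
Proof. by apply/imfsetP/idP => [[w wG ->] //|vG]; exists v. Qed.

Lemma card_grid_set : #|` grid_set| = n.
Proof.
rewrite card_fseq undup_id ?uniq_grid_vectors // /= size_cat !size_map !size_iota.
by move: k3_lt_n; lia.
Qed.

Lemma area_grid_set a b c :
  a \in grid_set -> b \in grid_set -> c \in grid_set -> area a b c <= 1 / 2.
Proof. by rewrite !mem_grid_set; move=> *; apply: area_cluster; exact: cluster_grid_vectors. Qed.

(* [z = (j, t)] encodes the line [j] and its point of abscissa [t]. *)
Definition incident_point z := ((z.1 %/ k + z.2 * (z.1 %% k)) * k + z.2)%N.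

Definition grid_triangle z : {fset 'rV[R]_3} :=
  [fset 0; grid_point (incident_point z); grid_line z.1].

Definition grid_incidences := [seq (j, t) | j <- iota 0 (k ^ 3), t <- iota 0 k].

Lemma mem_grid_incidences z : (z \in grid_incidences) = (z.1 < k ^ 3)%N && (z.2 < k)%N.
Proof.
apply/allpairsP/andP => [[[j t]] /= [+ + ->]|[zj zt]]; first by rewrite !mem_iota.
by exists z; rewrite !mem_iota; case: z zj zt.
Qed.

Lemma incident_point_lt z : z \in grid_incidences -> (incident_point z < n - (k ^ 3).+1)%N.
Proof.
rewrite mem_grid_incidences; case: z => j t /= /andP[lt_j lt_t]; rewrite /incident_point /=.
have lt_div : (j %/ k < k ^ 2)%N by rewrite ltn_divLR // -expnSr.
have lt_mod : (j %% k < k)%N by rewrite ltn_mod.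
have le_tm : (t * (j %% k) <= k.-1 * k.-1)%N by apply: leq_mul; lia.
have : ((j %/ k + t * (j %% k)) * k + t <= ((k ^ 2).-1 + k.-1 * k.-1) * k + k.-1)%N.
  by apply: leq_add; [rewrite leq_mul2r leq_add ?orbT //; lia | lia].
move: le_kn k_gt0; case: (k) => // k' le_k _; rewrite /= !expnS expn0 in le_k *; nia.
Qed.

Lemma grid_triangle_vertices z : z \in grid_incidences ->
  [/\ 0 \in grid_set, grid_point (incident_point z) \in grid_set & grid_line z.1 \in grid_set].
Proof.
move=> zG; have lt_i := incident_point_lt zG.
move: zG; rewrite mem_grid_incidences => /andP[lt_j _].
by split; rewrite mem_grid_set ?mem_head // inE mem_cat map_f ?mem_iota ?orbT.
Qed.

Lemma near_grid_triangle z : z \in grid_incidences ->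
  near 0 (grid_point (incident_point z)) /\ near 1 (grid_line z.1).
Proof.
move=> zG; have lt_i := incident_point_lt zG.
move: zG; rewrite mem_grid_incidences => /andP[lt_j _].
by split; [apply: near_grid_point | apply: near_grid_line]; move: lt_i lt_j k3_lt_n; lia.
Qed.

Lemma sqarea_grid_triangle z : z \in grid_incidences ->
  sqarea (grid_point (incident_point z)) (grid_line z.1) = 1.
Proof.
move=> zG; have [/near_unit p1 /near_unit l1] := near_grid_triangle zG.
move: zG; rewrite mem_grid_incidences => /andP[lt_j lt_t].
rewrite sqareaE p1 l1 grid_orthogonal ?expr0n ?mulr1 ?subr0 //.
by rewrite /incident_point divnMDl // modnMDl (divn_small lt_t) (modn_small lt_t) addn0.
Qed.

Lemma grid_triangle_max z : z \in grid_incidences ->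
  grid_triangle z \in max_area_triangles grid_set.
Proof.
move=> zG; have [set0P setP setL] := grid_triangle_vertices zG.
have z_area := sqarea_grid_triangle zG.
rewrite -[X in sqarea X]subr0 -[X in sqarea _ X]subr0 in z_area.
have z_neq0 : sqarea (grid_point (incident_point z) - 0) (grid_line z.1 - 0) != 0.
  by rewrite z_area oner_eq0.
apply/max_area_trianglesP; split=> [|T TP]; first exact: mem_triangles.
have [a [b [c [TE abc [aP bP cP] _ _]]]] := triangles_sorted (fun=> 0) TP.
rewrite {1}TE tri_areaE // tri_areaE ?sqareaB_uniq // [leRHS]areaE z_area sqrtr1.
exact: area_grid_set.
Qed.

Lemma grid_triangle_inj : {in grid_incidences &, injective grid_triangle}.
Proof.
move=> z z' zG z'G zz'; have [near0 near1] := near_grid_triangle zG.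
have [near0' near1'] := near_grid_triangle z'G.
have line_eq : z.1 = z'.1.
  have : grid_line z.1 \in grid_triangle z' by rewrite -zz' !inE eqxx !orbT.
  rewrite !inE (negPf (near_neq0 near1)) /= => /orP[/eqP lE|/eqP/grid_line_inj//].
  by have := near01_disjoint near0'; rewrite -lE near1.
have point_eq : incident_point z = incident_point z'.
  have : grid_point (incident_point z) \in grid_triangle z' by rewrite -zz' !inE eqxx !orbT.
  rewrite !inE (negPf (near_neq0 near0)) /= => /orP[/eqP/grid_point_inj//|/eqP pE].
  by have := near01_disjoint near0; rewrite pE near1'.
have /(congr1 (modn^~ k)) := point_eq; rewrite /incident_point !modnMDl.
move: zG z'G; rewrite !mem_grid_incidences => /andP[_ lt_t] /andP[_ lt_t'].
rewrite !modn_small // => t_eq.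
by rewrite [z]surjective_pairing [z']surjective_pairing line_eq t_eq.
Qed.

Lemma card_max_area_grid_set : (k ^ 4 <= #|` max_area_triangles grid_set|)%N.
Proof.
have -> : (k ^ 4)%N = size (map grid_triangle grid_incidences).
  by rewrite size_map size_allpairs !size_iota -expnSr.
apply: uniq_leq_size; last by move=> _ /mapP[z zG ->]; exact: grid_triangle_max.
rewrite map_inj_in_uniq; last exact: grid_triangle_inj.
by apply: allpairs_uniq; rewrite ?iota_uniq // => -[a b] [a' b'] _ _ [-> ->].
Qed.

End GridConstruction.

Theorem exists_many_max_area_triangles (R : realType) : exists2 c : R, 0 < c &
  forall n, (3 <= n)%N -> exists2 P : {fset 'rV[R]_3}, #|` P| = n &
    c * n%:R `^ (4 / 3) <= #|` max_area_triangles P|%:R.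
Proof.
exists (1 / 81); first by lra.
move=> n n_ge3; have ex_k : exists k, (3 * k ^ 3 <= n)%N by exists 1.
have k_le_n k : (3 * k ^ 3 <= n)%N -> (k <= n)%N.
  by apply: leq_trans; case: k => // k; rewrite !expnS expn0; nia.
case: (ex_maxnP ex_k k_le_n) => k le_kn k_max.
have k_gt0 : (0 < k)%N by exact: k_max.
have lt_nk : (n < 3 * k.+1 ^ 3)%N by rewrite ltnNge; apply/negP => /k_max; rewrite ltnn.
exists (grid_set R k n); first exact: card_grid_set.
apply: (@le_trans _ _ (k ^ 4)%:R); last by rewrite ler_nat card_max_area_grid_set.
have le_n : (n <= (3 * k) ^ 3)%N.
  by apply: leq_trans (ltnW lt_nk) _; case: k k_gt0 {le_kn k_max lt_nk} => // k _;
     rewrite !expnS expn0; nia.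
have : n%:R `^ (4 / 3) <= ((3 * k) ^ 4)%:R :> R.
  apply: (@le_trans _ _ (((3 * k) ^ 3)%:R `^ (4 / 3))); first by rewrite ler_nat_powR.
  rewrite !natrX -!powR_mulrn // -powRrM.
  by rewrite (_ : 3%:R * (4 / 3) = 4%:R) //; field.
by rewrite expnMn natrM; lra.
Qed.

Theorem theorem11 (R : realType) :
  (forall eps : R, 0 < eps ->
     exists C : R, forall (n : nat) (P : {fset 'rV[R]_3}),
       #|` P| = n ->
       #|` max_area_triangles P|%:R <= C * n%:R `^ (7 / 3 + eps)) /\
  (exists2 c : R, 0 < c &
     forall n : nat, (3 <= n)%N ->
       exists2 P : {fset 'rV[R]_3}, #|` P| = n &
         c * n%:R `^ (4 / 3) <= #|` max_area_triangles P|%:R).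
Proof.
by split; [exact: card_max_area_triangles_bound | exact: exists_many_max_area_triangles].
Qed.
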